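(* Suppose that $\Lambda$ is a path algebra modulo relations. If $\Lambda$ is left serial, then $\mathcal{P}^{<\infty}(\Lambda\text{-mod})$ is contravariantly finite in $\Lambda\text{-mod}$ and $\mathcal{P}^{<\infty}(\text{mod-}\Lambda)$ is contravariantly finite in $\text{mod-}\Lambda$.
   Context: A path algebra modulo relations is $\Lambda=KQ/I$ with $K$ a field, $Q$ a finite quiver and $I$ an admissible ideal of $KQ$ (so $\Lambda$ is a basic finite dimensional algebra). $\Lambda$ is left serial if all indecomposable projective left $\Lambda$-modules are uniserial. $\Lambda\text{-mod}$ (resp. $\text{mod-}\Lambda$) is the category of finitely generated left (resp. right) $\Lambda$-modules, and $\mathcal{P}^{<\infty}(\Lambda\text{-mod})$ (resp. $\mathcal{P}^{<\infty}(\text{mod-}\Lambda)$) its full subcategory of modules of finite projective dimension. $\mathcal{P}^{<\infty}(\Lambda\text{-mod})$ is contravariantly finite in $\Lambda\text{-mod}$ if for each $M\in\Lambda\text{-mod}$ there is a map $\phi:X\to M$ with $X\in\mathcal{P}^{<\infty}(\Lambda\text{-mod})$ through which every homomorphism from an object of $\mathcal{P}^{<\infty}(\Lambda\text{-mod})$ to $M$ factors. Similarly for right modules. *)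

(* Defs.v *)
From HB Require Import structures.
From mathcomp Require Import all_boot all_order all_algebra.
From mathcomp Require Import generic_quotient ring_quotient finmap.
From mathcomp.classical Require Import boolp.
From mathcomp.multinomials Require Import monalg.

Set Implicit Arguments.
Unset Strict Implicit.
Unset Printing Implicit Defensive.

Import GRing.Theory.
Local Open Scope ring_scope.

(* Two-sided ideals are [Prop]-valued, so that no decidability is assumed.   *)
Record ideal (A : pzRingType) := Ideal {
  ideal_mem :> A -> Prop;
  ideal_0 : ideal_mem 0;
  ideal_D : forall x y, ideal_mem x -> ideal_mem y -> ideal_mem (x + y);
  ideal_Ml : forall a x, ideal_mem x -> ideal_mem (a * x);
  ideal_Mr : forall a x, ideal_mem x -> ideal_mem (x * a) }.

Section IdealOperations.
Variable A : pzRingType.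

Definition ideal_le (I J : ideal A) : Prop := forall x, I x -> J x.

Definition ideal_full : ideal A.
Proof. by exists (fun=> True). Defined.

Definition ideal_gen_mem (S : A -> Prop) (x : A) : Prop :=
  forall I : ideal A, (forall y, S y -> I y) -> I x.

Definition ideal_gen (S : A -> Prop) : ideal A.
Proof.
exists (ideal_gen_mem S).
- by move=> I _; exact: ideal_0.
- by move=> x y Sx Sy I SI; apply: ideal_D; [exact: Sx|exact: Sy].
- by move=> a x Sx I SI; apply: ideal_Ml; exact: Sx.
- by move=> a x Sx I SI; apply: ideal_Mr; exact: Sx.
Defined.

Definition ideal_mul (I J : ideal A) : ideal A :=
  ideal_gen (fun x => exists a b, [/\ I a, J b & x = a * b]).

Definition ideal_exp (I : ideal A) (n : nat) : ideal A :=
  iter n (ideal_mul I) ideal_full.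

End IdealOperations.

Section QuotientRing.
Variables (A : pzRingType) (I : ideal A).
Local Open Scope quotient_scope.

Definition ideal_pred : {pred A} := fun x => `[< I x >].

Lemma ideal_predP x : reflect (I x) (x \in ideal_pred).
Proof. exact: asboolP. Qed.

Lemma ideal_pred_closed : zmod_closed ideal_pred.
Proof.
split=> [|x y /ideal_predP Ix /ideal_predP Iy]; apply/ideal_predP.
  exact: ideal_0.
by apply: ideal_D => //; rewrite -mulN1r; exact: ideal_Ml.
Qed.

HB.instance Definition _ := GRing.isZmodClosed.Build A ideal_pred
  ideal_pred_closed.

Definition quotient_ring : Type := Quotient.quot ideal_pred.

HB.instance Definition _ : EqQuotient A (Quotient.equiv ideal_pred)
  quotient_ring := EqQuotient.on quotient_ring.
HB.instance Definition _ := GRing.Zmodule.on quotient_ring.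

Definition quotient_pi (x : A) : quotient_ring := \pi_quotient_ring x.
Definition quotient_repr (u : quotient_ring) : A := repr u.

Lemma quotient_reprK u : quotient_pi (quotient_repr u) = u.
Proof. exact: reprK. Qed.

Lemma quotient_piP x y : quotient_pi x = quotient_pi y <-> I (x - y).
Proof.
split=> [/eqP|/ideal_predP Ixy]; last apply/eqP.
  by rewrite -Quotient.idealrBE => /ideal_predP.
by rewrite -Quotient.idealrBE.
Qed.

Definition quotient_one : quotient_ring := quotient_pi 1.
Definition quotient_mul (u v : quotient_ring) : quotient_ring :=
  quotient_pi (quotient_repr u * quotient_repr v).

Lemma quotient_piM x y :
  quotient_mul (quotient_pi x) (quotient_pi y) = quotient_pi (x * y).
Proof.
apply/quotient_piP.
set x' := quotient_repr _; set y' := quotient_repr _.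
have Ix : I (x' - x) by apply/quotient_piP; exact: quotient_reprK.
have Iy : I (y' - y) by apply/quotient_piP; exact: quotient_reprK.
have -> : x' * y' - x * y = (x' - x) * y' + x * (y' - y).
  by rewrite mulrBl mulrBr addrA subrK.
by apply: ideal_D; [exact: ideal_Mr|exact: ideal_Ml].
Qed.

Lemma quotient_piD x y :
  quotient_pi x + quotient_pi y = quotient_pi (x + y).
Proof. by rewrite /quotient_pi (@Quotient.pi_add A ideal_pred). Qed.

Lemma quotient_mulA : associative quotient_mul.
Proof.
move=> u v w; rewrite -[u]quotient_reprK -[v]quotient_reprK -[w]quotient_reprK.
by rewrite !quotient_piM mulrA.
Qed.

Lemma quotient_mul1 : left_id quotient_one quotient_mul.
Proof. by move=> u; rewrite -[u]quotient_reprK quotient_piM mul1r. Qed.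

Lemma quotient_1mul : right_id quotient_one quotient_mul.
Proof. by move=> u; rewrite -[u]quotient_reprK quotient_piM mulr1. Qed.

Lemma quotient_mulDl : left_distributive quotient_mul +%R.
Proof.
move=> u v w; rewrite -[u]quotient_reprK -[v]quotient_reprK -[w]quotient_reprK.
by rewrite !(quotient_piM, quotient_piD) mulrDl.
Qed.

Lemma quotient_mulDr : right_distributive quotient_mul +%R.
Proof.
move=> u v w; rewrite -[u]quotient_reprK -[v]quotient_reprK -[w]quotient_reprK.
by rewrite !(quotient_piM, quotient_piD) mulrDr.
Qed.

HB.instance Definition _ := GRing.Zmodule_isPzRing.Build quotient_ring
  quotient_mulA quotient_mul1 quotient_1mul quotient_mulDl quotient_mulDr.

Lemma quotient_pi_is_zmod_morphism : zmod_morphism quotient_pi.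
Proof.
move=> x y; apply: (addIr (quotient_pi y)).
by rewrite quotient_piD !subrK.
Qed.

Lemma quotient_pi_is_monoid_morphism : monoid_morphism quotient_pi.
Proof. by split=> // x y; rewrite -quotient_piM. Qed.

HB.instance Definition _ := GRing.isZmodMorphism.Build A quotient_ring
  quotient_pi quotient_pi_is_zmod_morphism.
HB.instance Definition _ := GRing.isMonoidMorphism.Build A quotient_ring
  quotient_pi quotient_pi_is_monoid_morphism.

End QuotientRing.

Record quiver := Quiver {
  vertex : finType;
  arrow : finType;
  src : arrow -> vertex;
  tgt : arrow -> vertex }.

Section Paths.
Variable Q : quiver.

(* [walk v s]: starting at [v], the arrows of [s] can be traversed in order. *)
Fixpoint walk (v : vertex Q) (s : seq (arrow Q)) : bool :=
  if s is a :: s' then (src a == v) && walk (tgt a) s' else true.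

Definition endpoint (v : vertex Q) (s : seq (arrow Q)) : vertex Q :=
  last v (map (@tgt Q) s).

Lemma walk_cat v s t : walk v (s ++ t) = walk v s && walk (endpoint v s) t.
Proof. by elim: s v => //= a s IHs v; rewrite IHs andbA. Qed.

Lemma endpoint_cat v s t : endpoint v (s ++ t) = endpoint (endpoint v s) t.
Proof. by rewrite /endpoint map_cat last_cat. Qed.

(* The starting vertex is recorded, so that each vertex has its own path of  *)
(* length 0.                                                                 *)
Record qpath := QPath {
  qpath_val :> vertex Q * seq (arrow Q);
  _ : walk qpath_val.1 qpath_val.2 }.
HB.instance Definition _ := [isSub for qpath_val].
HB.instance Definition _ := [Choice of qpath by <:].

Definition path_src (p : qpath) : vertex Q := (val p).1.
Definition path_arrows (p : qpath) : seq (arrow Q) := (val p).2.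
Definition path_tgt (p : qpath) : vertex Q :=
  endpoint (path_src p) (path_arrows p).

Definition vertex_path (v : vertex Q) : qpath :=
  @QPath (v, [::]) isT.

Lemma arrow_walk (a : arrow Q) : walk (src a) [:: a].
Proof. by rewrite /= eqxx. Qed.

Definition arrow_path (a : arrow Q) : qpath :=
  @QPath (src a, [:: a]) (arrow_walk a).

(* Paths compose like functions: [path_mul p q] is "[p] after [q]", and it   *)
(* is [None] unless [q] ends where [p] starts.                               *)
Definition path_mul (p q : qpath) : option qpath :=
  if path_tgt q == path_src p then
    insub (path_src q, path_arrows q ++ path_arrows p)
  else None.

Lemma path_mulP p q : path_tgt q = path_src p ->
  exists r, [/\ path_mul p q = Some r, path_src r = path_src q,
    path_tgt r = path_tgt p & path_arrows r = path_arrows q ++ path_arrows p].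
Proof.
case: p q => -[v s] /= vs [[w t] /= wt]; rewrite /path_tgt /path_src /= => E.
have H : walk w (t ++ s) by rewrite walk_cat wt E.
exists (@QPath (w, t ++ s) H); split=> //.
  rewrite /path_mul /path_tgt /path_src /= E eqxx.
  by case: insubP => [u _ eu|/=]; [congr Some; exact: val_inj|rewrite H].
by rewrite /= endpoint_cat E.
Qed.

Lemma path_mulN p q : path_tgt q != path_src p -> path_mul p q = None.
Proof. by rewrite /path_mul => /negbTE ->. Qed.

Lemma path_eq p q :
  path_src p = path_src q -> path_arrows p = path_arrows q -> p = q.
Proof.
case: p q => -[v s] vs [[w t] wt]; rewrite /path_src /path_arrows /= => E F.
by apply: val_inj; rewrite /= E F.
Qed.

Lemma path_mulA p q r :
  obind (path_mul p) (path_mul q r) = obind (path_mul^~ r) (path_mul p q).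
Proof.
have [E1|N1] := eqVneq (path_tgt r) (path_src q);
  have [E2|N2] := eqVneq (path_tgt q) (path_src p).
- have [x [-> sx tx ax]] := path_mulP E1; have [y [-> sy ty ay]] := path_mulP E2.
  have [z [/= -> sz _ az]] := path_mulP (etrans tx E2).
  have [w [-> sw _ aw]] := path_mulP (etrans E1 (esym sy)).
  by congr Some; apply: path_eq; [rewrite sz sw|rewrite az aw ax ay catA].
- have [x [-> sx tx ax]] := path_mulP E1; rewrite (path_mulN N2) /=.
  by rewrite path_mulN // tx.
- have [y [-> sy ty ay]] := path_mulP E2; rewrite (path_mulN N1) /=.
  by rewrite path_mulN // sy.
- by rewrite (path_mulN N1) (path_mulN N2).
Qed.

End Paths.

Definition path_algebra (K : fieldType) (Q : quiver) : Type :=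
  {malg K[qpath Q]}.
HB.instance Definition _ K Q := GRing.Lmodule.on (path_algebra K Q).

HB.lock Definition path_elt (K : fieldType) (Q : quiver) (p : qpath Q) :
  path_algebra K Q := << p >>.
Arguments path_elt K {Q} p.

Definition opath_elt (K : fieldType) (Q : quiver) (o : option (qpath Q)) :
  path_algebra K Q := if o is Some p then path_elt K p else 0.

HB.lock Definition pa_one (K : fieldType) (Q : quiver) : path_algebra K Q :=
  \sum_(v : vertex Q) path_elt K (vertex_path v).

HB.lock Definition pa_mul (K : fieldType) (Q : quiver)
    (f g : path_algebra K Q) : path_algebra K Q :=
  \sum_(p <- msupp f) \sum_(q <- msupp g)
    (f@_p * g@_q) *: opath_elt K (path_mul p q).
Arguments pa_mul {K Q} f g.

Section PathAlgebra.
Variables (K : fieldType) (Q : quiver).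
Local Notation path_algebra := (path_algebra K Q).
Local Notation path_elt := (@path_elt K Q).
Local Notation opath_elt := (@opath_elt K Q).
Local Notation pa_one := (pa_one K Q).
Implicit Types (f g h : path_algebra) (p q : qpath Q).

Lemma pa_mulE (d1 d2 : {fset qpath Q}) f g :
  {subset msupp f <= d1} -> {subset msupp g <= d2} ->
  pa_mul f g = \sum_(p <- d1) \sum_(q <- d2)
    (f@_p * g@_q) *: opath_elt (path_mul p q).
Proof.
move=> /fsubsetP s1 /fsubsetP s2; rewrite pa_mul.unlock.
rewrite (big_fset_incl _ s1) => [|p _ /mcoeff_outdom ->].
  apply: eq_bigr => p _; rewrite (big_fset_incl _ s2) // => q _.
  by move=> /mcoeff_outdom ->; rewrite mulr0 scale0r.
by rewrite big1 // => q _; rewrite mul0r scale0r.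
Qed.

Lemma pa_mulDl : left_distributive (@pa_mul K Q) +%R.
Proof.
move=> f g h; pose d := (msupp f `|` msupp g)%fset.
have fd : {subset msupp f <= d} by move=> p pf; rewrite in_fsetU pf.
have gd : {subset msupp g <= d} by move=> p pg; rewrite in_fsetU pg orbT.
have fgd : {subset msupp (f + g) <= d} by exact/fsubsetP/msuppD_le.
rewrite !(@pa_mulE d (msupp h)) //.
rewrite -big_split; apply: eq_bigr => p _; rewrite -big_split.
by apply: eq_bigr => q _; rewrite mcoeffD mulrDl scalerDl.
Qed.

Lemma pa_mulDr : right_distributive (@pa_mul K Q) +%R.
Proof.
move=> h f g; pose d := (msupp f `|` msupp g)%fset.
have fd : {subset msupp f <= d} by move=> p pf; rewrite in_fsetU pf.
have gd : {subset msupp g <= d} by move=> p pg; rewrite in_fsetU pg orbT.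
have fgd : {subset msupp (f + g) <= d} by exact/fsubsetP/msuppD_le.
rewrite !(@pa_mulE (msupp h) d) //.
rewrite -big_split; apply: eq_bigr => p _; rewrite -big_split.
by apply: eq_bigr => q _; rewrite mcoeffD mulrDr scalerDl.
Qed.

Lemma pa_mulZl c f g : pa_mul (c *: f) g = c *: pa_mul f g.
Proof.
rewrite !(@pa_mulE (msupp f) (msupp g)) //; last exact/fsubsetP/msuppZ_le.
rewrite scaler_sumr; apply: eq_bigr => p _; rewrite scaler_sumr.
by apply: eq_bigr => q _; rewrite mcoeffZ -mulrA scalerA.
Qed.

Lemma pa_mulZr c f g : pa_mul f (c *: g) = c *: pa_mul f g.
Proof.
rewrite !(@pa_mulE (msupp f) (msupp g)) //; last exact/fsubsetP/msuppZ_le.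
rewrite scaler_sumr; apply: eq_bigr => p _; rewrite scaler_sumr.
by apply: eq_bigr => q _; rewrite mcoeffZ mulrCA scalerA.
Qed.

Lemma pa_mul0l f : pa_mul 0 f = 0.
Proof. by rewrite -[0](scale0r (0 : path_algebra)) pa_mulZl !scale0r. Qed.

Lemma pa_mul0r f : pa_mul f 0 = 0.
Proof. by rewrite -[0](scale0r (0 : path_algebra)) pa_mulZr !scale0r. Qed.

Lemma pa_mul_suml (J : Type) (s : seq J) (F : J -> path_algebra) g :
  pa_mul (\sum_(j <- s) F j) g = \sum_(j <- s) pa_mul (F j) g.
Proof.
by apply: (big_morph (pa_mul^~ g)) => [x y|]; rewrite ?pa_mulDl ?pa_mul0l.
Qed.

Lemma pa_mul_sumr (J : Type) (s : seq J) (F : J -> path_algebra) g :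
  pa_mul g (\sum_(j <- s) F j) = \sum_(j <- s) pa_mul g (F j).
Proof.
by apply: (big_morph (pa_mul g)) => [x y|]; rewrite ?pa_mulDr ?pa_mul0r.
Qed.

Lemma pa_mulUU p q :
  pa_mul (path_elt p) (path_elt q) = opath_elt (path_mul p q).
Proof.
rewrite (@pa_mulE [fset p]%fset [fset q]%fset) ?path_elt.unlock; last first.
- exact/fsubsetP/msuppU_le.
- exact/fsubsetP/msuppU_le.
by rewrite !big_seq_fset1 !mcoeffUU mulr1 scale1r.
Qed.

Lemma path_eltE f : f = \sum_(p <- msupp f) f@_p *: path_elt p.
Proof.
have malgU (c : K) p : << c *g p >> = c *: (<< p >> : {malg K[qpath Q]}).
  apply/malgP => q; rewrite malgZ_def fgscaleE [LHS]mcoeffU.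
  by rewrite (@mcoeffU _ _ p 1 q); case: (p == q); rewrite ?mulr1 ?mulr0.
rewrite path_elt.unlock {1}[f]monalgE; apply: eq_bigr => p _; exact: malgU.
Qed.

Lemma pa_ind (P : path_algebra -> Prop) :
  P 0 -> (forall f g, P f -> P g -> P (f + g)) ->
  (forall c f, P f -> P (c *: f)) -> (forall p, P (path_elt p)) ->
  forall f, P f.
Proof.
move=> P0 PD PZ PU f; rewrite [f]path_eltE.
by apply: big_ind => // p _; exact: PZ.
Qed.

Lemma pa_mulA : associative (@pa_mul K Q).
Proof.
move=> f g h; elim/pa_ind: f => [|f1 f2 E1 E2|c f E|p].
- by rewrite !pa_mul0l.
- by rewrite !pa_mulDl E1 E2.
- by rewrite !pa_mulZl E.
elim/pa_ind: g => [|f1 f2 E1 E2|c f E|q].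
- by rewrite !(pa_mul0l, pa_mul0r).
- by rewrite !(pa_mulDl, pa_mulDr) E1 E2.
- apply: etrans (congr1 (pa_mul (path_elt p)) (pa_mulZl c f h)) _.
  apply: etrans (pa_mulZr c (path_elt p) (pa_mul f h)) _; rewrite E; symmetry.
  apply: etrans (congr1 (pa_mul^~ h) (pa_mulZr c (path_elt p) f)) _.
  exact: pa_mulZl.
elim/pa_ind: h => [|f1 f2 E1 E2|c f E|r].
- by rewrite !pa_mul0r.
- by rewrite !pa_mulDr E1 E2.
- by rewrite !pa_mulZr E.
have -> : pa_mul (path_elt p) (pa_mul (path_elt q) (path_elt r)) =
    opath_elt (obind (path_mul p) (path_mul q r)).
  by rewrite pa_mulUU; case: path_mul => [x|] /=; rewrite ?pa_mulUU ?pa_mul0r.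
rewrite path_mulA pa_mulUU; case: path_mul => [x|] /=.
  by rewrite pa_mulUU.
by rewrite pa_mul0l.
Qed.

Lemma vertex_path_mull v p : path_mul (vertex_path v) p =
  if path_tgt p == v then Some p else None.
Proof.
have [E|N] := eqVneq (path_tgt p) v; last exact: path_mulN.
have [r [-> sr _ ar]] := @path_mulP Q (vertex_path v) p E.
by congr Some; apply: path_eq => //; rewrite ar cats0.
Qed.

Lemma vertex_path_mulr v p : path_mul p (vertex_path v) =
  if v == path_src p then Some p else None.
Proof.
have [E|N] := eqVneq v (path_src p); last exact: path_mulN.
have [r [-> sr _ ar]] := @path_mulP Q p (vertex_path v) E.
by congr Some; apply: path_eq => //; rewrite sr.
Qed.

Lemma pa_mul1f : left_id pa_one (@pa_mul K Q).
Proof.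
elim/pa_ind => [|f1 f2 E1 E2|c f E|p].
- by rewrite pa_mul0r.
- by rewrite pa_mulDr E1 E2.
- by rewrite pa_mulZr E.
rewrite pa_one.unlock pa_mul_suml (bigD1 (path_tgt p)) //= pa_mulUU vertex_path_mull eqxx.
rewrite big1 ?addr0 // => v vp.
by rewrite pa_mulUU vertex_path_mull eq_sym (negbTE vp).
Qed.

Lemma pa_mulf1 : right_id pa_one (@pa_mul K Q).
Proof.
elim/pa_ind => [|f1 f2 E1 E2|c f E|p].
- by rewrite pa_mul0l.
- by rewrite pa_mulDl E1 E2.
- by rewrite pa_mulZl E.
rewrite pa_one.unlock pa_mul_sumr (bigD1 (path_src p)) //= pa_mulUU vertex_path_mulr eqxx.
rewrite big1 ?addr0 // => v vp.
by rewrite pa_mulUU vertex_path_mulr (negbTE vp).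
Qed.

HB.instance Definition _ := GRing.Zmodule_isPzRing.Build path_algebra
  pa_mulA pa_mul1f pa_mulf1 pa_mulDl pa_mulDr.

Lemma path_eltM p q : path_elt p * path_elt q = opath_elt (path_mul p q).
Proof. exact: pa_mulUU. Qed.

Lemma path_algebra_scalerAl (c : K) f g : c *: (f * g) = (c *: f) * g.
Proof. exact/esym/pa_mulZl. Qed.

Lemma path_algebra_scalerAr (c : K) f g : c *: (f * g) = f * (c *: g).
Proof. exact/esym/pa_mulZr. Qed.

Definition arrow_ideal : ideal path_algebra :=
  ideal_gen (fun x => exists a : arrow Q, x = path_elt (arrow_path a)).

Definition admissible (I : ideal path_algebra) : Prop :=
  ideal_le I (ideal_exp arrow_ideal 2) /\
  exists2 m, (2 <= m)%N & ideal_le (ideal_exp arrow_ideal m) I.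

End PathAlgebra.

(* Modules over [R] below are left modules; right [R]-modules are left       *)
(* modules over the converse ring [R^c].                                     *)
Section Modules.
Variable R : pzRingType.

Definition surjective (M N : Type) (f : M -> N) : Prop :=
  forall y, exists x, f x = y.

Definition exact_at (M N P : lmodType R) (f : {linear M -> N})
    (g : {linear N -> P}) : Prop :=
  forall y, g y = 0 <-> exists x, f x = y.

Definition fin_gen (M : lmodType R) : Prop :=
  exists (n : nat) (e : 'I_n -> M),
    forall x, exists c : 'I_n -> R, x = \sum_(i < n) c i *: e i.

Definition projective (P : lmodType R) : Prop :=
  forall (M N : lmodType R) (g : {linear M -> N}) (f : {linear P -> N}),
    surjective g -> exists h : {linear P -> M}, forall x, g (h x) = f x.

(* A projective resolution 0 -> P n -> ... -> P 0 -> M -> 0.                 *)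
Definition has_projective_resolution (n : nat) (M : lmodType R) : Prop :=
  exists (P : nat -> lmodType R) (d : forall i, {linear P i.+1 -> P i})
      (e : {linear P 0 -> M}),
    [/\ forall i, projective (P i),
        surjective e,
        exact_at (d 0) e,
        forall i, exact_at (d i.+1) (d i) &
        forall i, (n < i)%N -> forall x : P i, x = 0].

Definition finite_pdim (M : lmodType R) : Prop :=
  exists n, has_projective_resolution n M.

(* The objects of P^{<oo}(R-mod).                                            *)
Definition fin_gen_finite_pdim (M : lmodType R) : Prop :=
  fin_gen M /\ finite_pdim M.

(* [C] and [A] are the object classes of full subcategories of R-modules.    *)
Definition contravariantly_finite (C A : lmodType R -> Prop) : Prop :=
  forall M, A M -> exists (X : lmodType R) (phi : {linear X -> M}), C X /\
    forall (Y : lmodType R) (f : {linear Y -> M}), C Y ->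
      exists g : {linear Y -> X}, forall y, f y = phi (g y).

Definition is_submodule (M : lmodType R) (U : M -> Prop) : Prop :=
  U 0 /\ forall a x y, U x -> U y -> U (a *: x + y).

Definition uniserial (M : lmodType R) : Prop :=
  forall U V : M -> Prop, is_submodule U -> is_submodule V ->
    (forall x, U x -> V x) \/ (forall x, V x -> U x).

Definition indecomposable (M : lmodType R) : Prop :=
  (exists x : M, x <> 0) /\
  forall U V : M -> Prop, is_submodule U -> is_submodule V ->
    (forall x, exists u v, [/\ U u, V v & x = u + v]) ->
    (forall x, U x -> V x -> x = 0) ->
    (forall x, U x -> x = 0) \/ (forall x, V x -> x = 0).

Definition left_serial : Prop :=
  forall P : lmodType R, projective P -> indecomposable P -> uniserial P.

End Modules.

(* Main.v *)
Require Import Defs.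
From HB Require Import structures.
From mathcomp Require Import all_boot all_order all_algebra zify finmap.
From mathcomp.classical Require Import boolp functions.
From mathcomp.multinomials Require Import monalg.

(* For M over a ring G with idempotent e, put B = eGe.  Suppose that the modules
   killed by e have finite projective dimension and that eY is a projective
   B-module whenever Y has finite projective dimension.  If F -> M is a free
   cover, the pullback X of M -> Hom_B(eG, eM) <- Hom_B(eG, eF) satisfies
   eX = eF, so kernel and cokernel of F -> X are killed by e and X has finite
   projective dimension; and Y -> M lifts to X because eY -> eM lifts to eF.

   A left serial bound quiver has at most one arrow out of each vertex.  Write
   s v for the next vertex, l v for the Loewy length of the projective at v, and
   L v for the vertex l v steps after v.  On the left, the second syzygy of the
   simple at x has its composition factors between L x and L (s x); on the right
   it has the factors z with L z = x.  Where this descent is well-founded, the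
   simple has finite projective dimension; e is the sum of the other vertices.
   Then B is generated over its vertices by one nilpotent element b, "go to the
   next vertex of e", and with p, "go to the last one", the multiplications by b
   and p alternately form an exact sequence on eG.  By periodicity it
   remains exact on eY for Y of finite projective dimension, and exactness
   forces eY to be projective: a lift to a projective of a basis of eY / bY
   becomes bijective after multiplication by e. *)

Set Implicit Arguments.
Unset Strict Implicit.
Unset Printing Implicit Defensive.

Import GRing.Theory.
Local Open Scope ring_scope.

(** Right projectives need not be uniserial, as several arrows may end at one vertex. But a vertex
    recurrent on the right is preceded by arbitrarily long chains of recurrent vertices, so it lies
    on a cycle of the successor map, where that map is invertible. After cutting by e, both sides
    therefore obey the same combinatorics of strings, with predecessors in place of successors on
    the right. Only two facts about the recurrent set R matter. Call overhang of v the letters that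
    lie in the string of the neighbour of v but beyond the end of the string of v. If v is in R, its
    overhang meets R, since otherwise the descent from v would be well-founded; if v is not in R,
    its overhang avoids R. The first fact gives p b = 0. By the second, the first letter w in R of
    any string leads to the same last letter in R as the string itself, so p w is nonzero. A string
    thus contributes to eG the chain w, b w, ..., b^n w = p w, from which kernels and images of b
    and p can be read off. *)

Definition linear_of (R : pzRingType) (M N : lmodType R) (f : M -> N)
    (f_lin : linear f) : {linear M -> N} :=
  HB.pack f (GRing.isLinear.Build R M N *:%R f f_lin).

(** * Submodules and projective modules *)

Section SubmoduleType.
Variables (R : pzRingType) (M : lmodType R) (U : M -> Prop).
Hypothesis subU : is_submodule U.

(** The vacuous [let] makes the predicate depend on the proof [subU], so that its closure instance
    needs no further data after the section is closed. *)
Definition submod_pred : {pred M} := let _ := subU in fun x => `[< U x >].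

Lemma submod_pred_closed : submod_closed submod_pred.
Proof.
case: subU => U0 US; split=> [|a x y /asboolP Ux /asboolP Uy]; apply/asboolP => //.
exact: US.
Qed.

HB.instance Definition _ := GRing.isSubmodClosed.Build R M submod_pred
  submod_pred_closed.

Record submod := Submod { submod_val : M; _ : submod_val \in submod_pred }.

HB.instance Definition _ := [isSub for submod_val].
HB.instance Definition _ := [Choice of submod by <:].
HB.instance Definition _ := [SubChoice_isSubLmodule of submod by <:].

Lemma submodP (x : submod) : U (val x).
Proof. by case: x => x Ux; exact/asboolP. Qed.

Definition to_submod (x : M) (Ux : U x) : submod := Submod (introT (asboolP _) Ux).

Definition submod_incl : {linear submod -> M} := val.

End SubmoduleType.

Section Submodules.
Variables (R : pzRingType).
Implicit Types M N : lmodType R.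

Lemma submoduleD M (U : M -> Prop) x y :
  is_submodule U -> U x -> U y -> U (x + y).
Proof. by case=> _ US Ux Uy; rewrite -[x]scale1r; exact: US. Qed.

Lemma submoduleZ M (U : M -> Prop) a x : is_submodule U -> U x -> U (a *: x).
Proof. by case=> U0 US Ux; rewrite -[_ *: _]addr0; exact: US. Qed.

Lemma submoduleN M (U : M -> Prop) x : is_submodule U -> U x -> U (- x).
Proof. by move=> sU Ux; rewrite -scaleN1r; exact: submoduleZ. Qed.

Lemma submoduleB M (U : M -> Prop) x y :
  is_submodule U -> U x -> U y -> U (x - y).
Proof. by move=> sU Ux Uy; apply: submoduleD => //; exact: submoduleN. Qed.

Lemma submodule_sum M (U : M -> Prop) (I : Type) (s : seq I) (P : pred I) (F : I -> M) :
  is_submodule U -> (forall i, P i -> U (F i)) -> U (\sum_(i <- s | P i) F i).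
Proof.
move=> sU UF; apply: (big_ind U) => //; first by case: sU.
by move=> x y; exact: submoduleD.
Qed.

Lemma submodule_preim M N (f : {linear M -> N}) (U : N -> Prop) :
  is_submodule U -> is_submodule (fun x => U (f x)).
Proof.
case=> U0 US; split=> [|a x y Ux Uy]; first by rewrite linear0.
by rewrite linearP; exact: US.
Qed.

Lemma submodule0 M : is_submodule (fun x : M => x = 0).
Proof. by split=> // a x y -> ->; rewrite scaler0 addr0. Qed.

Lemma submoduleT M : is_submodule (fun _ : M => True).
Proof. by []. Qed.

Lemma submodule_image M N (f : {linear M -> N}) :
  is_submodule (fun y => exists x, f x = y).
Proof.
split=> [|a _ _ [x <-] [y <-]]; first by exists 0; rewrite linear0.
by exists (a *: x + y); rewrite linearP.
Qed.

End Submodules.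

Section Projectives.
Variables (R : pzRingType).

Lemma projective_prod (P P' : lmodType R) :
  projective P -> projective P' -> projective (P * P')%type.
Proof.
move=> pP pP' M N g f gS.
have l1 : linear (fun x : P => f (x, 0)).
  by move=> a x y; rewrite -linearP /=; congr (f _); congr pair; rewrite /= ?scaler0 ?addr0.
have l2 : linear (fun x : P' => f (0, x)).
  by move=> a x y; rewrite -linearP /=; congr (f _); congr pair; rewrite /= ?scaler0 ?addr0.
have [h1 E1] := pP M N g (linear_of l1) gS.
have [h2 E2] := pP' M N g (linear_of l2) gS.
have l3 : linear (fun x : P * P' => h1 x.1 + h2 x.2).
  by move=> a x y /=; rewrite !linearP scalerDr addrACA.
exists (linear_of l3) => x /=; rewrite linearD E1 E2 /= -linearD /=.
by congr (f _); case: x => x y; congr pair; rewrite /= ?addr0 ?add0r.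
Qed.

Variables (I : finType) (eps : I -> R).
Hypothesis epsK : forall i, eps i * eps i = eps i.

Definition idem_sum_mem (c : {ffun I -> R^o}) : Prop :=
  forall i, c i * eps i = c i.

Lemma idem_sum_submod : is_submodule idem_sum_mem.
Proof.
split=> [i|a c d Hc Hd i]; first by rewrite ffunE mul0r.
rewrite !ffunE mulrDl Hd; congr (_ + _).
by rewrite -[in RHS](Hc i); rewrite /GRing.scale /= mulrA.
Qed.

(* The direct sum of the modules [R * eps i]. *)
Definition idem_sum : lmodType R := submod idem_sum_submod.

Definition idem_coord (x : idem_sum) (i : I) : R := submod_incl idem_sum_submod x i.

Lemma idem_coordP (x y : idem_sum) : (forall i, idem_coord x i = idem_coord y i) -> x = y.
Proof. by move=> E; apply: val_inj; apply/ffunP => i; exact: E. Qed.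

Lemma idem_coordK (x : idem_sum) i : idem_coord x i * eps i = idem_coord x i.
Proof. exact: (submodP x). Qed.

Lemma idem_coordD x y i : idem_coord (x + y) i = idem_coord x i + idem_coord y i.
Proof. by rewrite /idem_coord linearD ffunE. Qed.

Lemma idem_coord0 i : idem_coord 0 i = 0.
Proof. by rewrite /idem_coord linear0 ffunE. Qed.

Lemma idem_coordZ a x i : idem_coord (a *: x) i = a * idem_coord x i.
Proof. by rewrite /idem_coord linearZ ffunE. Qed.

Lemma idem_of_subproof (c : I -> R) : idem_sum_mem [ffun i => c i * eps i].
Proof. by move=> i; rewrite !ffunE -mulrA epsK. Qed.

Definition idem_of (c : I -> R) : idem_sum := to_submod idem_sum_submod (idem_of_subproof c).

Lemma idem_ofE c i : idem_coord (idem_of c) i = c i * eps i.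
Proof. by rewrite /idem_coord /= ffunE. Qed.

Definition idem_gen (i : I) : idem_sum := idem_of (fun j => (j == i)%:R).

Lemma idem_sumE (x : idem_sum) : x = \sum_i idem_coord x i *: idem_gen i.
Proof.
apply: idem_coordP => j.
rewrite (big_morph (idem_coord ^~ j) (fun x y => idem_coordD x y j) (idem_coord0 j)).
rewrite (bigD1 j) //= big1 ?addr0 => [|i ij].
  by rewrite idem_coordZ idem_ofE eqxx mul1r idem_coordK.
by rewrite idem_coordZ idem_ofE eq_sym (negbTE ij) mul0r mulr0.
Qed.

Lemma idem_lin_subproof (N : lmodType R) (m : I -> N) :
  linear (fun x : idem_sum => \sum_i idem_coord x i *: m i).
Proof.
move=> a x y; rewrite scaler_sumr -big_split; apply: eq_bigr => i _ /=.
by rewrite idem_coordD idem_coordZ scalerDl scalerA.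
Qed.

Definition idem_lin (N : lmodType R) (m : I -> N) : {linear idem_sum -> N} :=
  linear_of (idem_lin_subproof m).

Lemma idem_linE (N : lmodType R) (m : I -> N) x :
  idem_lin m x = \sum_i idem_coord x i *: m i.
Proof. by []. Qed.

Lemma idem_sum_projective : projective idem_sum.
Proof.
move=> M N g f gS.
have /choice [m Em] : forall i, exists m, g m = f (idem_gen i) by move=> i; exact: gS.
exists (idem_lin m) => x; rewrite idem_linE {2}[x]idem_sumE !linear_sum.
by apply: eq_bigr => i _; rewrite !linearZ /= Em.
Qed.

Lemma idem_sum_fin_gen : fin_gen idem_sum.
Proof.
exists #|I|, (fun k => idem_gen (enum_val k)) => x.
exists (fun k => idem_coord x (enum_val k)); rewrite {1}[x]idem_sumE.
rewrite (reindex (@enum_val I predT)) /=; last exact/onW_bij/enum_val_bij.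
done.
Qed.

End Projectives.

(** * Projective dimension of subquotients *)

Section ProjectiveDimension.
Variable R : pzRingType.
Implicit Types M N P : lmodType R.

(* For submodules [U <= W] of [M]: the projective dimension of [W / U] is less
   than [n]. *)
Fixpoint pd_lt (n : nat) (M : lmodType R) (W U : M -> Prop) : Prop :=
  if n is n'.+1 then
    exists (P : lmodType R) (g : {linear P -> M}),
      [/\ projective P, forall x, W (g x), forall m, W m -> exists x, U (m - g x) &
          @pd_lt n' P (fun x => U (g x)) (fun x => x = 0)]
  else forall x, W x -> U x.

Lemma pd_lt_ext n M (W W' U U' : M -> Prop) :
  (forall x, W x <-> W' x) -> (forall x, U x <-> U' x) ->
  pd_lt n W U -> pd_lt n W' U'.
Proof.
move=> EW EU; have -> : W' = W by apply/funext => x; apply/propext; split=> /EW.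
by have -> : U' = U by apply/funext => x; apply/propext; split=> /EU.
Qed.

(** The hypotheses say that [f] induces an isomorphism of [W / U] with [W' / U']. A cover of the
    source, composed with [f], is a cover of the target with the same kernel. *)
Lemma pd_lt_push n M N (f : {linear M -> N}) (W U : M -> Prop) (W' U' : N -> Prop) :
  is_submodule W -> is_submodule U' -> (forall x, W x -> W' (f x)) ->
  (forall x, W x -> (U x <-> U' (f x))) ->
  (forall y, W' y -> exists2 x, W x & U' (y - f x)) ->
  pd_lt n W U -> pd_lt n W' U'.
Proof.
move=> sW sU' WW' UU' fS; case: n => [H y /fS[x Wx Uy]|n [P [g [pP gW gS H]]]].
  by rewrite -[y](subrK (f x)); apply: submoduleD => //; apply/UU' => //; exact: H.
exists P, (f \o g : {linear P -> N}); split=> //= [x|y /fS[x Wx Uy]|].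
- exact: WW'.
- have [z Uz] := gS _ Wx; exists z.
  rewrite -[y](subrK (f x)) -addrA -linearB; apply: submoduleD => //.
  by apply/UU' => //; apply: submoduleB.
- by apply: pd_lt_ext H => // x; apply: UU'.
Qed.

(** Against the direction of [f], the cover of [W' / U'] has to be lifted to [W]; projectivity of
    the covering module provides the lift. *)
Lemma pd_lt_pull n M N (f : {linear M -> N}) (W U : M -> Prop) (W' U' : N -> Prop) :
  is_submodule W -> is_submodule U' -> (forall x, W x -> W' (f x)) ->
  (forall x, W x -> (U x <-> U' (f x))) ->
  (forall y, W' y -> exists2 x, W x & U' (y - f x)) ->
  pd_lt n W' U' -> pd_lt n W U.
Proof.
move=> sW sU' WW' UU' fS; case: n => [H x Wx|n [P [g [pP gW gS H]]]].
  by apply/UU' => //; apply: H; exact: WW'.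
(* Pairs of [x] in [P] and a lift of [g x] to [W] modulo [U']: a section of the projection to [P]
   chooses such lifts linearly. *)
pose E (z : P * M) := W z.2 /\ U' (f z.2 - g z.1).
have sE : is_submodule E.
  split=> [|a x y [Wx Ux] [Wy Uy]].
    by split; [case: sW|rewrite /= (linear0 f) (linear0 g) subr0; case: sU'].
  split; first by case: sW => _; apply.
  rewrite /= (linearP f) (linearP g) opprD addrACA -scalerN -scalerDr.
  by case: sU' => _; apply.
have qlin : linear (fun z : submod sE => (val z).1) by move=> a x y.
have [x|s Es] := pP _ _ (linear_of qlin) (idfun : {linear P -> P}).
  have [w Ww Uw] := fS _ (gW x).
  have Exw : E (x, w) by split=> //=; rewrite -opprB; exact: submoduleN.
  by exists (to_submod sE Exw).
have glin : linear (fun x => (val (s x)).2) by move=> a x y; rewrite linearP.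
have gE x : W (linear_of glin x) /\ U' (f (linear_of glin x) - g x).
  by have [] := submodP (s x); have /= -> := Es x.
exists P, (linear_of glin); split=> // [x|m Wm|].
- exact: (gE x).1.
- have [x Ux] := gS _ (WW' _ Wm); exists x; apply/UU'.
    by apply: submoduleB => //; exact: (gE x).1.
  rewrite linearB -[f m](subrK (g x)) -addrA; apply: submoduleD => //.
  by rewrite -opprB; apply: submoduleN => //; exact: (gE x).2.
- apply: pd_lt_ext H => // x; split=> Ux.
    apply/UU'; first exact: (gE x).1.
    by rewrite -[f _](subrK (g x)); apply: submoduleD => //; exact: (gE x).2.
  rewrite -[g x](subKr (f (linear_of glin x))); apply: submoduleB => //.
    by apply/UU' => //; exact: (gE x).1.
  exact: (gE x).2.
Qed.

(* The horseshoe lemma.  Covers of [V / U] and of [W / V] map to [M] itself, so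
   that they add up to a cover of [W / U] without any lifting. *)
Lemma pd_lt_extension n M (W V U : M -> Prop) :
  is_submodule W -> is_submodule V -> is_submodule U ->
  (forall x, V x -> W x) -> (forall x, U x -> V x) ->
  pd_lt n V U -> pd_lt n W V -> pd_lt n W U.
Proof.
elim: n M W V U => [|n IHn] M W V U sW sV sU VW UV.
  by move=> VU WV x /WV /VU.
move=> [P [g [pP gV gS H]]] [P' [g' [pP' gW' gS' H']]].
have hlin : linear (fun x : P * P' => g x.1 + g' x.2).
  by move=> a x y /=; rewrite !linearP scalerDr addrACA.
pose h := linear_of hlin; have hE x : h x = g x.1 + g' x.2 by [].
have ilin : linear (fun x : P => (x, 0 : P')).
  by move=> a x y; congr pair; rewrite /= scaler0 addr0.
have slin : linear (fun x : P * P' => x.2) by [].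
exists (P * P')%type, h; split=> [|x|m Wm|]; first exact: projective_prod.
- by apply: submoduleD => //; apply: VW.
- have [x' Vx'] := gS' _ Wm; have [x Ux] := gS _ Vx'; exists (x, x').
  by rewrite hE /= opprD addrCA addrC.
have sT : is_submodule (fun x => U (h x)) by exact: submodule_preim.
have sZ : is_submodule (fun x : P * P' => x.2 = 0 /\ U (g x.1)).
  split=> [|a x y [x2 Ux] [y2 Uy]]; first by rewrite /= linear0; case: sU.
  by rewrite /= x2 y2 scaler0 addr0 linearP; split=> //; case: sU => _; apply.
apply: (IHn _ _ (fun x : P * P' => x.2 = 0 /\ U (g x.1))) => //.
- exact: submodule0.
- by move=> x [x2 Ux]; rewrite hE x2 linear0 addr0.
- by move=> x ->; rewrite /= linear0; split=> //; case: sU.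
- apply: (pd_lt_push (f := linear_of ilin)) H => //.
  + exact: submodule_preim.
  + exact: submodule0.
  + by move=> x Ux; split=> [->|[]].
  + by move=> [x x'] /= [-> Ux]; exists x => //; rewrite subrr.
- apply: (pd_lt_pull (f := linear_of slin)) H' => //.
  + exact: submodule0.
  + move=> x Ux /=; rewrite -(addKr (g x.1) (g' x.2)) addrC.
    by apply: submoduleB => //; exact: UV.
  + move=> x Ux; split=> [[]//|/= x2]; split=> //.
    by move: Ux; rewrite hE x2 linear0 addr0.
  + move=> x' /= /gS[x Ux]; exists (- x, x'); last by rewrite subrr.
    by rewrite /= linearN addrC.
Qed.

Lemma pd_ltS n M (W U : M -> Prop) :
  W 0 -> is_submodule U -> pd_lt n W U -> pd_lt n.+1 W U.
Proof.
elim: n M W U => [|n IHn] M W U W0 sU H.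
  pose g := @idem_lin R _ (fun _ : 'I_0 => 0) M (fun=> 0).
  have E x : g x = 0 by rewrite /g idem_linE big_ord0.
  exists (idem_sum (fun _ : 'I_0 => 0 : R)), g.
  split=> [|x|m Wm|x _].
  - by apply: idem_sum_projective => i; rewrite mul0r.
  - by rewrite E.
  - by exists 0; rewrite E subr0; exact: H.
  - by apply: idem_coordP => -[].
case: H => P [g [pP gW gS H]]; exists P, g; split=> //.
by apply: IHn => //; [rewrite linear0; case: sU|exact: submodule0].
Qed.

Lemma pd_lt_leq m n M (W U : M -> Prop) : (m <= n)%N ->
  W 0 -> is_submodule U -> pd_lt m W U -> pd_lt n W U.
Proof.
by move=> /subnK <- W0 sU H; elim: (n - m)%N => // k IHk; rewrite addSn; exact: pd_ltS.
Qed.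

Definition fin_pd M (W U : M -> Prop) : Prop := exists n, pd_lt n W U.

Lemma fin_pd_extension M (W V U : M -> Prop) :
  is_submodule W -> is_submodule V -> is_submodule U ->
  (forall x, V x -> W x) -> (forall x, U x -> V x) ->
  fin_pd V U -> fin_pd W V -> fin_pd W U.
Proof.
move=> sW sV sU VW UV [m Hm] [n Hn]; exists (maxn m n).
apply: (@pd_lt_extension _ _ W V U) => //.
- by apply: pd_lt_leq Hm; rewrite ?leq_maxl //; case: sV.
- by apply: pd_lt_leq Hn; rewrite ?leq_maxr //; case: sW.
Qed.

Lemma fin_pd_cover P M (W U : M -> Prop) (g : {linear P -> M}) :
  projective P -> (forall x, W (g x)) -> (forall m, W m -> exists x, U (m - g x)) ->
  fin_pd (fun x => U (g x)) (fun x => x = 0) -> fin_pd W U.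
Proof. by move=> pP gW gS [n H]; exists n.+1, P, g. Qed.

Lemma pd_lt_resolution n M (W : M -> Prop) : is_submodule W ->
  pd_lt n W (fun x => x = 0) ->
  exists (P : nat -> lmodType R) (d : forall i, {linear P i.+1 -> P i})
      (e : {linear P 0 -> M}),
    [/\ forall i, projective (P i),
        forall y, W y <-> exists x, e x = y,
        exact_at (d 0) e,
        forall i, exact_at (d i.+1) (d i) &
        forall i, (n <= i)%N -> forall x : P i, x = 0].
Proof.
elim: n M W => [|n IHn] M W sW.
  move=> W0; pose Z := idem_sum (fun _ : 'I_0 => 0 : R).
  have Z0 (x : Z) : x = 0 by apply: idem_coordP => -[].
  exists (fun=> Z), (fun=> idfun), (@idem_lin R _ (fun _ : 'I_0 => 0) M (fun=> 0)); split=> //.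
  - by move=> i; apply: idem_sum_projective => j; rewrite mul0r.
  - move=> y; split=> [/W0 ->|[x <-]]; first by exists 0; rewrite linear0.
    by rewrite idem_linE big_ord0; case: sW.
  - by move=> y; split=> _; [exists y|rewrite (Z0 y) linear0].
  - by move=> i y; split=> _; [exists y|rewrite (Z0 y)].
case=> P [g [pP gW gS H]].
have [P' [d' [e' [pP' e'S ex0 exS P'0]]]] :=
  IHn _ _ (submodule_preim g (submodule0 M)) H.
pose PP i := if i is j.+1 then P' j else P.
pose dd i : {linear PP i.+1 -> PP i} :=
  match i with 0 => e' | j.+1 => d' j end.
exists PP, dd, g; split=> //.
- by case.
- move=> y; split=> [/gS[x /eqP]|[x <-]//].
  by rewrite subr_eq0 => /eqP ->; exists x.
- by case.
- by case.
Qed.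

Lemma fin_pd_finite_pdim M :
  fin_pd (fun _ : M => True) (fun x => x = 0) -> finite_pdim M.
Proof.
move=> [n /(pd_lt_resolution (submoduleT M))[P [d [e [pP eS ex0 exS P0]]]]].
exists n, P, d, e; split=> // [y|i /ltnW]; last exact: P0.
by apply/eS.
Qed.

End ProjectiveDimension.

(** * Modules of finite dimension over a central field *)

Section FiniteDimension.
Variables (K : fieldType) (G : pzRingType) (kap : {rmorphism K -> G}).
Hypothesis kapC : forall c x, kap c * x = x * kap c.
Implicit Types M N : lmodType G.

(** The sum is restricted to a subset [A] so that inductions on dimension can discard one index at a
    time. *)
Definition comb M (I : finType) (z : I -> M) (A : {set I}) (c : I -> K) : M :=
  \sum_(i in A) kap (c i) *: z i.

Lemma combZ M (I : finType) (z : I -> M) A c a :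
  kap a *: comb z A c = comb z A (fun i => a * c i).
Proof. by rewrite scaler_sumr; apply: eq_bigr => i _; rewrite rmorphM scalerA. Qed.

Lemma combB M (I : finType) (z : I -> M) A c d :
  comb z A c - comb z A d = comb z A (fun i => c i - d i).
Proof. by rewrite -sumrB; apply: eq_bigr => i _; rewrite rmorphB scalerBl. Qed.

Lemma combD1 M (I : finType) (z : I -> M) (A : {set I}) i c : i \in A ->
  comb z A c = kap (c i) *: z i + comb z (A :\ i) c.
Proof. by move=> Ai; rewrite /comb (big_setD1 i). Qed.

Lemma combT M (I : finType) (z : I -> M) c : comb z setT c = \sum_i kap (c i) *: z i.
Proof. by apply: eq_bigl => i; rewrite inE. Qed.

Lemma scale_kapC M c a (x : M) : kap c *: (a *: x) = a *: (kap c *: x).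
Proof. by rewrite !scalerA kapC. Qed.

Definition fdim M : Prop :=
  exists (I : finType) (z : I -> M), forall x, exists c, x = comb z setT c.

Lemma fdim_fin_gen M : fdim M -> fin_gen M.
Proof.
move=> [I [z zS]]; exists #|I|, (fun k => z (enum_val k)) => x.
have [c ->] := zS x; exists (fun k => kap (c (enum_val k))).
by rewrite combT (reindex (@enum_val I predT)) //=; exact/onW_bij/enum_val_bij.
Qed.

Lemma fin_gen_fdim M : fdim G^o -> fin_gen M -> fdim M.
Proof.
move=> [J [g gS]] [n [e eS]].
exists ('I_n * J)%type, (fun ij => (g ij.2 : G) *: e ij.1) => x.
have [c ->] := eS x; have /choice[d dE] : forall i, exists d, c i = comb g setT d.
  by move=> i; exact: (gS (c i)).
exists (fun ij => d ij.1 ij.2).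
rewrite combT -(pair_big xpredT xpredT
  (fun i j => kap (d i j) *: ((g j : G) *: e i))) /=.
apply: eq_bigr => i _; rewrite dE combT scaler_suml.
by apply: eq_bigr => j _; rewrite scalerA.
Qed.

(** Gaussian elimination: either no element of [S] needs the index [i], or an [x0] with nonzero
    coefficient at [i] clears that coefficient from all others. [S] is only a [K]-subspace, since
    elimination does not respect the action of [G]. *)
Lemma fdim_embedding_on M N (I : finType) (z : I -> N) (A : {set I}) (S : M -> Prop)
    (f : M -> N) :
  (forall x y, S x -> S y -> S (x - y)) -> (forall c x, S x -> S (kap c *: x)) ->
  (forall x y, f (x - y) = f x - f y) -> (forall c x, f (kap c *: x) = kap c *: f x) ->
  (forall x, S x -> f x = 0 -> x = 0) ->
  (forall x, S x -> exists c, f x = comb z A c) ->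
  exists (J : finType) (w : J -> M), forall x, S x -> exists c, x = comb w setT c.
Proof.
move=> SB + fB fZ f_inj; move En: #|A| => n.
elim: n A En S SB f_inj => [|n IHn] A cA S SB f_inj SZ fS.
  exists 'I_0, (fun _ => 0) => x Sx; exists (fun _ => 0).
  have [c Ec] := fS x Sx; rewrite (f_inj x Sx) ?combT ?big_ord0 //.
  by rewrite Ec /comb (cards0_eq cA) big_set0.
have [i Ai] : exists i, i \in A by apply/set0Pn; rewrite -card_gt0 cA.
have cA' : #|A :\ i| = n by move: cA; rewrite (cardsD1 i) Ai => -[].
pose S' x := S x /\ exists c, f x = comb z (A :\ i) c.
have [J [w wS]] : exists (J : finType) (w : J -> M),
    forall x, S' x -> exists c, x = comb w setT c.
  apply: (IHn (A :\ i)) => //.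
  - move=> x y [Sx [c Ec]] [Sy [d Ed]]; split; first exact: SB.
    by exists (fun i => c i - d i); rewrite fB Ec Ed combB.
  - by move=> x [Sx _]; exact: f_inj.
  - move=> a x [Sx [c Ec]]; split; first exact: SZ.
    by exists (fun i => a * c i); rewrite fZ Ec combZ.
  - by move=> x [].
have [SS'|/existsNP[x0 /not_implyP[Sx0 nS'x0]]] := pselect (forall x, S x -> S' x).
  by exists J, w => x /SS' /wS.
have [c0 Ec0] := fS _ Sx0.
have c0i : c0 i != 0.
  apply: contra_notN nS'x0 => /eqP c0i; split=> //; exists c0.
  by rewrite Ec0 (combD1 _ _ Ai) c0i rmorph0 scale0r add0r.
exists (unit + J)%type, (fun j => if j is inr j' then w j' else x0) => x Sx.
have [c Ec] := fS _ Sx.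
have [|d Ed] := wS (x - kap (c i / c0 i) *: x0).
  split; first by apply: SB => //; exact: SZ.
  exists (fun j => c j - c i / c0 i * c0 j).
  rewrite fB fZ Ec Ec0 combZ combB (combD1 _ _ Ai).
  by rewrite divfK // subrr rmorph0 scale0r add0r.
exists (fun j => if j is inr j' then d j' else c i / c0 i).
rewrite combT big_sumType /= (big_pred1 tt); last by case.
by rewrite -combT -Ed addrC subrK.
Qed.

Lemma fdim_embedding M N (f : M -> N) :
  (forall x y, f (x - y) = f x - f y) -> (forall c x, f (kap c *: x) = kap c *: f x) ->
  (forall x, f x = 0 -> x = 0) -> fdim N -> fdim M.
Proof.
move=> fB fZ f_inj [I [z zS]].
have [J [w wS]] : exists (J : finType) (w : J -> M),
    forall x, True -> exists c, x = comb w setT c.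
  apply: (@fdim_embedding_on M N I z setT (fun _ => True) f) => // x _.
  exact: f_inj.
by exists J, w => x; exact: wS.
Qed.

End FiniteDimension.

(** * Filtrations with simple factors *)

Section Filtrations.
Variables (K : fieldType) (G : pzRingType) (kap : {rmorphism K -> G}).
Hypothesis kapC : forall c x, kap c * x = x * kap c.
Hypothesis Gfd : fdim kap G^o.
Variables (V A : finType) (ev : V -> G) (al : A -> G) (so ta : A -> V).
Hypothesis evK : forall v, ev v * ev v = ev v.
Hypothesis ev_orth : forall v w, v != w -> ev v * ev w = 0.
Hypothesis ev1 : \sum_v ev v = 1.
Hypothesis al_so : forall a, al a * ev (so a) = al a.
Hypothesis al_ta : forall a, ev (ta a) * al a = al a.
Hypothesis al_gen : forall x, exists c h,
  x = \sum_v kap (c v) * ev v + \sum_a h a * al a.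
Hypothesis al_nil : exists N, forall s : seq A, size s = N -> \prod_(a <- s) al a = 0.
Implicit Types M : lmodType G.

(** This is [U + K y]. If [y] lies at one vertex and all arrows send it into [U], it is a submodule,
    and modulo [U] it is zero or simple. *)
Definition add_line M (U : M -> Prop) (y : M) (m : M) : Prop :=
  exists c, U (m - kap c *: y).

Lemma add_line_submod M (U : M -> Prop) v y :
  is_submodule U -> ev v *: y = y -> (forall a, U (al a *: y)) ->
  is_submodule (add_line U y).
Proof.
move=> sU vy Ua; split.
  by exists 0; rewrite rmorph0 scale0r subrr; case: sU.
move=> x m m' [c Uc] [c' Uc']; have [d [h E]] := al_gen x.
exists (c * d v + c').
rewrite rmorphD rmorphM scalerDl opprD addrACA; apply: submoduleD => //.
have -> : kap c * kap (d v) = kap (d v) * kap c by rewrite kapC.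
have Ex : x *: y = kap (d v) *: y + \sum_a h a *: (al a *: y).
  rewrite E scalerDl !scaler_suml; congr (_ + _).
    rewrite (bigD1 v) //= big1 ?addr0 => [|w wv]; first by rewrite -scalerA vy.
    by rewrite -{1}vy -scalerA [ev w *: _]scalerA ev_orth // scale0r scaler0.
  by apply: eq_bigr => a _; rewrite scalerA.
have -> : x *: m - (kap (d v) * kap c) *: y =
    x *: (m - kap c *: y) + kap c *: \sum_a h a *: (al a *: y).
  rewrite scalerBr -(scale_kapC kapC) Ex scalerDr opprD addrA addrNK.
  by rewrite !scalerA -!rmorphM mulrC.
apply: submoduleD; rewrite //; first exact: submoduleZ.
by apply: submoduleZ => //; apply: submodule_sum => // a _; apply: submoduleZ.
Qed.

(** Otherwise every element of [W] outside [U] that lies at one vertex could be multiplied by some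
    arrow without entering [U], and repetition would give nonzero products of arbitrarily many
    arrows. *)
Lemma socle_element M (W U : M -> Prop) w :
  is_submodule W -> is_submodule U -> W w -> ~ U w ->
  exists v y, [/\ W y, ~ U y, ev v *: y = y & forall a, U (al a *: y)].
Proof.
move=> sW sU Ww nUw; apply: contrapT => none.
have step k : exists v y, [/\ W y, ~ U y, ev v *: y = y &
    exists s w', size s = k /\ y = (\prod_(a <- s) al a) *: w'].
  elim: k => [|k [v [y [Wy nUy vy [s [w' [sk Ey]]]]]]].
    have [v nUv] : exists v, ~ U (ev v *: w).
      apply: contrapT => /forallNP H; apply: nUw; rewrite -[w]scale1r -ev1 scaler_suml.
      by apply: submodule_sum => // v _; apply: contrapT; exact: H.
    exists v, (ev v *: w); split=> //; first exact: submoduleZ.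
      by rewrite scalerA evK.
    by exists [::], (ev v *: w); rewrite big_nil scale1r.
  have [a nUa] : exists a, ~ U (al a *: y).
    by apply: contrapT => /forallNP H; apply: none; exists v, y; split=> // a;
      apply: contrapT; exact: H.
  exists (ta a), (al a *: y); split=> //; first exact: submoduleZ.
    by rewrite scalerA al_ta.
  by exists (a :: s), w'; rewrite /= sk big_cons -scalerA -Ey.
have [N N0] := al_nil; have [v [y [_ nUy _ [s [w' [sN Ey]]]]]] := step N.
by apply: nUy; rewrite Ey N0 // scale0r; case: sU.
Qed.

(* [v] is good when the simple module at [v] has finite projective dimension. *)
Definition good_vertex (v : V) : Prop :=
  forall M (U : M -> Prop) (y : M), is_submodule U -> ev v *: y = y ->
    (forall a, U (al a *: y)) -> fin_pd (add_line U y) U.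

Lemma fin_pd_filtration M (I : finType) (z : I -> M) (W U : M -> Prop) :
  is_submodule W -> is_submodule U -> (forall m, U m -> W m) ->
  (forall m, W m -> exists c, U (m - comb kap z setT c)) ->
  (forall v, good_vertex v \/ forall m, W m -> U (ev v *: m)) ->
  fin_pd W U.
Proof.
move=> sW; move: {1}[set: I] => B; move En: #|B| => n.
elim: n B En U => [|n IHn] B cB U sU UW Wz gW.
  exists 0%N => m /Wz[c]; rewrite /comb (cards0_eq cB) big_set0 subr0.
  by [].
have [WU|/existsNP[w /not_implyP[Ww nUw]]] := pselect (forall m, W m -> U m).
  by exists 0%N.
have [v [y [Wy nUy vy Ua]]] := socle_element sW sU Ww nUw.
have gv : good_vertex v by case: (gW v) => // /(_ _ Wy); rewrite vy.
have [c Uc] := Wz _ Wy.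
have [i Bi ci] : exists2 i, i \in B & c i != 0.
  apply: contrapT => H; apply: nUy; move: Uc; rewrite /comb big1 ?subr0 // => i Bi.
  have [->|ci] := eqVneq (c i) 0; first by rewrite rmorph0 scale0r.
  by case: H; exists i.
have sU' := add_line_submod sU vy Ua.
have UU' m : U m -> add_line U y m by exists 0; rewrite rmorph0 scale0r subr0.
apply: (fin_pd_extension sW sU' sU) => //.
- move=> m [d Ud]; rewrite -[m](subrK (kap d *: y)); apply: submoduleD => //.
    exact: UW.
  exact: submoduleZ.
- exact: gv.
apply: (IHn (B :\ i)) => //.
- by move: cB; rewrite (cardsD1 i) Bi => -[].
- move=> m [d Ud]; rewrite -[m](subrK (kap d *: y)); apply: submoduleD => //.
    exact: UW.
  exact: submoduleZ.
- move=> m Wm; have [d Ud] := Wz _ Wm.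
  (* Modulo [U], [y] is [comb kap z B c] with [c i] nonzero, so subtracting a multiple of [y]
     removes [z i]. *)
  exists (fun j => d j - d i / c i * c j), (d i / c i).
  have -> : comb kap z (B :\ i) (fun j => d j - d i / c i * c j) =
      comb kap z B d - kap (d i / c i) *: comb kap z B c.
    rewrite combZ combB (combD1 _ _ _ Bi).
    by rewrite divfK // subrr rmorph0 scale0r add0r.
  have -> : forall t : M, m - (comb kap z B d - kap (d i / c i) *: t) - kap (d i / c i) *: y
      = (m - comb kap z B d) - kap (d i / c i) *: (y - t).
    by move=> t; rewrite scalerBr !opprB !addrA; congr (_ + _); rewrite addrAC.
  by apply: submoduleB => //; exact: submoduleZ.
- move=> v'; case: (gW v') => [|H]; first by left.
  by right=> m Wm; apply: UU'; exact: H.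
Qed.

Lemma fin_pd_filtration_fdim M (W U : M -> Prop) :
  fdim kap M -> is_submodule W -> is_submodule U -> (forall m, U m -> W m) ->
  (forall v, good_vertex v \/ forall m, W m -> U (ev v *: m)) ->
  fin_pd W U.
Proof.
move=> [I [z zS]] sW sU UW; apply: (fin_pd_filtration (z := z)) => // m _.
by have [c ->] := zS m; exists c; rewrite subrr; case: sU.
Qed.

Variable below : V -> V -> Prop.
(* The projective cover of the radical of [G * ev x] has summands
   [G * ev (ta a)], for the arrows [a] with [so a = x]; [below x v] bounds the
   composition factors of its kernel. *)
Hypothesis belowP : forall x v (h : A -> G),
  (forall a, ev v * h a = h a) ->
  (forall a, h a * (if so a == x then ev (ta a) else 0) = h a) ->
  \sum_a h a * al a = 0 -> (exists a, h a <> 0) -> below x v.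

(** The kernel of [g0] is the radical of [G * ev x], which [g1] covers in turn. The kernel of [g1]
    involves only vertices below [x], whose simple modules are settled by induction, and a
    filtration assembles them. *)
Lemma good_vertexP x : Acc (fun v w => below w v) x -> good_vertex x.
Proof.
elim=> {}x _ IHx M U y sU xy Ua.
pose e0 := fun _ : unit => ev x.
(* Arrows that do not start at [x] get the idempotent 0, so that the sum can run over all arrows. *)
pose e1 := fun a => if so a == x then ev (ta a) else 0.
have e0K i : e0 i * e0 i = e0 i by exact: evK.
have e1K a : e1 a * e1 a = e1 a by rewrite /e1; case: eqP => _; rewrite ?evK ?mul0r.
pose g0 := @idem_lin G _ e0 M (fun _ => y).
have g0E t : g0 t = idem_coord t tt *: y by rewrite /g0 idem_linE (big_pred1 tt) //; case.
pose g1 := @idem_lin G _ e1 _ (fun a => al a *: idem_gen e0K tt).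
have g1E t : idem_coord (g1 t) tt = (\sum_a idem_coord t a * al a) * ev x.
  rewrite /g1 idem_linE.
  rewrite (big_morph (@idem_coord _ _ e0 ^~ tt) (fun x y => idem_coordD x y tt)
    (idem_coord0 _ tt)).
  rewrite mulr_suml; apply: eq_bigr => a _.
  by rewrite !idem_coordZ idem_ofE eqxx mul1r mulrA.
have term a (t : idem_sum e1) : idem_coord t a * al a * ev x = idem_coord t a * al a.
  move: (idem_coordK t a); move: (idem_coord t a) => u <-; rewrite /e1.
  case: eqP => [<-|_].
    by rewrite -!mulrA al_so.
  by rewrite mulr0 !mul0r.
have g1E' t : idem_coord (g1 t) tt = \sum_a idem_coord t a * al a.
  by rewrite g1E mulr_suml; apply: eq_bigr => a _; exact: term.
have sL := add_line_submod sU xy Ua.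
have [Uy|nUy] := pselect (U y).
  by exists 0%N => m [c Uc]; rewrite -[m](subrK (kap c *: y)); apply: submoduleD => //;
    exact: submoduleZ.
apply: (fin_pd_cover (g := g0)).
- exact: idem_sum_projective.
- move=> t; rewrite g0E; apply: submoduleZ => //.
  by exists 1; rewrite rmorph1 scale1r subrr; case: sU.
- move=> m [c Uc]; exists (kap c *: idem_gen e0K tt).
  by rewrite g0E idem_coordZ idem_ofE eqxx mul1r -scalerA xy.
apply: (fin_pd_cover (g := g1)).
- exact: idem_sum_projective.
- move=> t; rewrite g0E g1E' scaler_suml; apply: submodule_sum => // a _.
  by rewrite -scalerA; apply: submoduleZ.
- move=> t; rewrite g0E => Ut; have [c [h E]] := al_gen (idem_coord t tt).
  (* A nonzero coefficient at [x] could be inverted and would put [y] itself into [U]. *)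
  have cx : c x = 0.
    apply/eqP/negP => /negP cx; apply: nUy.
    suff : U (kap (c x) *: y).
      move=> /(submoduleZ (kap (c x)^-1) sU).
      by rewrite scalerA -rmorphM mulVf // rmorph1 scale1r.
    have -> : kap (c x) *: y = idem_coord t tt *: y - \sum_a h a *: (al a *: y).
      rewrite E scalerDl !scaler_suml (bigD1 x) //= big1 ?addr0 => [|w wx].
        by rewrite -scalerA xy -[LHS]addr0 -addrA; congr (_ + _);
          rewrite -sumrB big1 // => a _; rewrite scalerA subrr.
      by rewrite -{1}xy -scalerA [ev w *: _]scalerA ev_orth // scale0r scaler0.
    apply: submoduleB => //; apply: submodule_sum => // a _; exact: submoduleZ.
  exists (idem_of e1K h); apply/eqP; rewrite subr_eq0; apply/eqP.
  apply: idem_coordP => -[]; rewrite g1E' -[LHS]idem_coordK E mulrDl !mulr_suml.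
  rewrite big1 ?add0r => [|w _].
    apply: eq_bigr => a _; rewrite idem_ofE /e1 /e0; case: eqP => [<-|/eqP n].
      by rewrite -!mulrA al_so al_ta.
    by rewrite -al_so -!mulrA ev_orth // !(mulr0, mul0r).
  have [->|wx] := eqVneq w x; first by rewrite cx rmorph0 !mul0r.
  by rewrite -mulrA ev_orth // mulr0.
apply: fin_pd_filtration_fdim.
- exact: (fin_gen_fdim Gfd (idem_sum_fin_gen e1K)).
- exact: (submodule_preim g1 (submodule0 _)).
- exact: submodule0.
- by move=> m ->; rewrite linear0.
(* If [ev v] does not kill the kernel of [g1], some nonzero [ev v *: t] is a relation among the
   arrows, and [v] is below [x]. *)
move=> v; have [H|/existsNP[t /not_implyP[t0 nvt]]] :=
  pselect (forall t, g1 t = 0 -> ev v *: t = 0); first by right.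
left; apply: IHx; apply: (@belowP x v (fun a => ev v * idem_coord t a)).
- by move=> a; rewrite mulrA evK.
- by move=> a; rewrite -mulrA idem_coordK.
- rewrite (eq_bigr (fun a => ev v * (idem_coord t a * al a))) => [|a _]; last by rewrite mulrA.
  by rewrite -mulr_sumr -g1E' t0 idem_coord0 mulr0.
apply: contrapT => /forallNP H; apply: nvt; apply: idem_coordP => a.
by rewrite idem_coordZ idem_coord0; apply: contrapT; exact: H.
Qed.

End Filtrations.

(** * Approximations by pullback *)

Lemma pair_ext (A B : Type) (x y : A * B) : x.1 = y.1 -> x.2 = y.2 -> x = y.
Proof. by case: x y => a b [c d] /= -> ->. Qed.

(** * Coinduced modules of additive maps *)

Section Coinduced.
Variables (G : pzRingType) (F : lmodType G).

Definition additive_pred : {pred (G -> F)} :=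
  fun h => `[< forall x y, h (x + y) = h x + h y >].

Lemma additive_pred_closed : zmod_closed additive_pred.
Proof.
split=> [|h k /asboolP hD /asboolP kD]; apply/asboolP => x y /=.
  by rewrite addr0.
by rewrite !fctE hD kD opprD addrACA.
Qed.

HB.instance Definition _ := GRing.isZmodClosed.Build (G -> F) additive_pred
  additive_pred_closed.

Record coind := Coind { coind_val :> G -> F; _ : coind_val \in additive_pred }.

HB.instance Definition _ := [isSub for coind_val].
HB.instance Definition _ := [Choice of coind by <:].
HB.instance Definition _ := [SubChoice_isSubZmodule of coind by <:].

Lemma coindD (h : coind) x y : h (x + y) = h x + h y.
Proof. by case: h => h /= /asboolP. Qed.

Lemma coind_scale_subproof (a : G) (h : coind) :
  (fun x => h (x * a)) \in additive_pred.
Proof. by apply/asboolP => x y; rewrite mulrDl coindD. Qed.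

Definition coind_scale a h : coind := Coind (coind_scale_subproof a h).

Lemma coindP (h k : coind) : (forall x, h x = k x) -> h = k.
Proof. by move=> E; apply: val_inj; apply/funext. Qed.

Lemma coind_addE (h k : coind) x : (h + k) x = h x + k x.
Proof. by []. Qed.

Lemma coind_scaleA a b h : coind_scale a (coind_scale b h) = coind_scale (a * b) h.
Proof. by apply: coindP => x /=; rewrite mulrA. Qed.

Lemma coind_scale1 : left_id 1 coind_scale.
Proof. by move=> h; apply: coindP => x /=; rewrite mulr1. Qed.

Lemma coind_scaleDr : right_distributive coind_scale +%R.
Proof. by move=> a h k; apply: coindP. Qed.

Lemma coind_scaleDl h : {morph coind_scale^~ h : a b / a + b}.
Proof. by move=> a b; apply: coindP => x /=; rewrite mulrDr coindD. Qed.

HB.instance Definition _ := GRing.Zmodule_isLmodule.Build G coind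
  coind_scaleA coind_scale1 coind_scaleDr coind_scaleDl.

Lemma coind_scaleE a (h : coind) x : (a *: h) x = h (x * a).
Proof. by []. Qed.

End Coinduced.

Section Approximation.
Variables (K : fieldType) (G : pzRingType) (kap : {rmorphism K -> G}).
Hypothesis kapC : forall c x, kap c * x = x * kap c.
Hypothesis Gfd : fdim kap G^o.
Variable e : G.
Hypothesis eK : e * e = e.
Hypothesis fin_pd_corner0 : forall (M : lmodType G) (W U : M -> Prop),
  fdim kap M -> is_submodule W -> is_submodule U -> (forall m, U m -> W m) ->
  (forall m, W m -> U (e *: m)) -> fin_pd W U.
Hypothesis corner_cover : forall Y : lmodType G, fin_gen Y -> finite_pdim Y ->
  exists (P : lmodType G) (T : {linear P -> Y}),
    [/\ projective P, forall x, e *: x = x -> T x = 0 -> x = 0 &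
        forall y, exists2 x, e *: x = x & T x = e *: y].

Section Pullback.
Variables (M F : lmodType G) (pr : {linear F -> M}).

(* The pullback of [M -> Hom_B(eG, eM) <- Hom_B(eG, eF)], where [B = eGe]. *)
Definition corner_pullback_mem (z : M * coind F) : Prop :=
  [/\ forall a x, z.2 (e * a * e * x) = (e * a * e) *: z.2 x,
      forall x, z.2 (e * x) = z.2 x &
      forall x, pr (z.2 x) = (e * x) *: z.1].

Lemma corner_pullback_submod : is_submodule corner_pullback_mem.
Proof.
split.
  split=> // [a x|x] /=; first by rewrite scaler0.
  by rewrite scaler0; exact: linear0.
move=> b [m h] [m' h'] [/= h1 h2 h3] [/= k1 k2 k3].
have -> : b *: (m, h) + (m', h') = (b *: m + m', b *: h + h') by [].
split=> [a x|x|x]; rewrite [_.2]/= ?[_.1]/=.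
- by rewrite !coind_addE !coind_scaleE -mulrA h1 k1 scalerDr.
- by rewrite !coind_addE !coind_scaleE -mulrA h2 k2.
- by rewrite !coind_addE !coind_scaleE linearD h3 k3 scalerDr scalerA mulrA.
Qed.

Definition corner_pullback : lmodType G := submod corner_pullback_submod.

Lemma unit_subproof (f : F) : (fun x => (e * x) *: f) \in @additive_pred G F.
Proof. by apply/asboolP => x y; rewrite mulrDr scalerDl. Qed.

(** The canonical map from the cover to the pullback; its second component is the unit of
    coinduction along [e]. *)
Definition unit_pair (f : F) : M * coind F := (pr f, Coind (unit_subproof f)).

Lemma unit_pair_mem f : corner_pullback_mem (unit_pair f).
Proof.
split=> [a x|x|x] /=.
- by rewrite scalerA !mulrA eK -(mulrA (e * a) e e) eK.
- by rewrite mulrA eK.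
- by rewrite linearZ.
Qed.

Definition unit_fun f : corner_pullback := to_submod corner_pullback_submod (unit_pair_mem f).

Lemma unit_fun_linear : linear unit_fun.
Proof.
move=> a f g; apply: val_inj; congr pair; first by rewrite /= linearP.
by apply: coindP => x; rewrite coind_addE coind_scaleE /= scalerDr scalerA mulrA.
Qed.

Definition unit_map : {linear F -> corner_pullback} := linear_of unit_fun_linear.

(** The second component of [e *: z] is determined by that of [z] at 1: at [x * e] it equals
    [e * x * e] applied to this value. *)
Lemma corner_unit_onto (z : corner_pullback) : exists f, unit_map f = e *: z.
Proof.
case: (submodP z) => h1 h2 h3; exists (e *: (val z).2 1).
apply: val_inj; rewrite /=; congr pair; first by rewrite linearZZ h3 mulr1 scalerA eK.
apply: coindP => x; change ((e * x) *: (e *: (val z).2 1) = (val z).2 (x * e)).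
rewrite scalerA.
have -> : (val z).2 (x * e) = (val z).2 (e * x * e * 1) by rewrite mulr1 -mulrA h2.
by rewrite h1.
Qed.

Hypotheses (Ffd : fdim kap F) (Mfd : fdim kap M) (pF : projective F).

(** The maps in the pullback are [K]-linear, because [e * kap c] equals [e * kap c * e] and so lies
    in the corner. Their values on a finite spanning set of [G] determine them, which embeds the
    pullback into [M] times a power of [F]. *)
Lemma corner_pullback_fdim : fdim kap corner_pullback.
Proof.
have [J [g gS]] := Gfd.
pose N : lmodType G := (M * {ffun J -> F})%type.
have Nfd : fdim kap N.
  have [I1 [z1 S1]] := Mfd; have [I2 [z2 S2]] := Ffd.
  exists (I1 + J * I2)%type, (fun i => match i with
    | inl i => (z1 i, 0)
    | inr ji => (0, [ffun j => if j == ji.1 then z2 ji.2 else 0]) end : N) => -[m h].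
  have [c Ec] := S1 m; have /choice[d Ed] := fun j => S2 (h j).
  exists (fun i => match i with inl i => c i | inr ji => d ji.1 ji.2 end).
  rewrite combT big_sumType /=.
  have i1 : linear (fun x : M => (x, 0) : N).
    by move=> a x y; congr pair; rewrite /= scaler0 addr0.
  have i2 : linear (fun x : {ffun J -> F} => (0, x) : N).
    by move=> a x y; congr pair; rewrite /= scaler0 addr0.
  have -> : (m, h) = linear_of i1 m + linear_of i2 h.
    by congr pair; rewrite /= ?addr0 ?add0r.
  congr (_ + _).
    by rewrite Ec combT linear_sum; apply: eq_bigr => i _; rewrite linearZ.
  have -> : h = \sum_(ji : J * I2) kap (d ji.1 ji.2) *:
      [ffun j => if j == ji.1 then z2 ji.2 else 0].
    apply/ffunP => j; rewrite sum_ffunE Ed combT.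
    rewrite -(pair_big xpredT xpredT (fun j' i => (kap (d j' i) *:
      [ffun j => if j == j' then z2 i else 0]) j)) /=.
    rewrite (bigD1 j) //= [X in _ + X]big1 ?addr0 => [|j' jj'].
      by apply: eq_bigr => i _; rewrite !ffunE eqxx.
    by apply: big1 => i _; rewrite !ffunE eq_sym (negbTE jj') scaler0.
  by rewrite linear_sum; apply: eq_bigr => i _; rewrite linearZ.
pose v := submod_incl corner_pullback_submod.
have hK (z : corner_pullback) c x : (v z).2 (kap c * x) = kap c *: (v z).2 x.
  case: (submodP z) => h1 h2 h3.
  have hx : e *: (v z).2 x = (v z).2 x.
    by have := h1 1 x; rewrite mulr1 eK h2.
  rewrite -[LHS]h2 mulrA.
  have -> : e * kap c = e * kap c * e by rewrite -mulrA kapC mulrA eK -kapC.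
  by rewrite h1 -mulrA kapC mulrA eK -kapC -scalerA hx.
pose f1 z := (v z).1; pose f2 z := [ffun j => (v z).2 (g j)].
pose f (z : corner_pullback) : N := (f1 z, f2 z).
have f1B x y : f1 (x - y) = f1 x - f1 y by rewrite /f1 linearB.
have f2B x y : f2 (x - y) = f2 x - f2 y.
  by apply/ffunP => j; rewrite !ffunE linearB.
have f1Z c x : f1 (kap c *: x) = kap c *: f1 x by rewrite /f1 linearZ.
have f2Z c x : f2 (kap c *: x) = kap c *: f2 x.
  by apply/ffunP => j; rewrite !ffunE linearZ -hK kapC.
apply: (@fdim_embedding _ _ _ _ N f) => //.
- by move=> x y; rewrite /f f1B f2B.
- by move=> c x; rewrite /f f1Z f2Z.
move=> z [z1 /ffunP z2]; apply: val_inj; apply: pair_ext; first exact: z1.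
apply: coindP => x; have [c ->] := gS x; rewrite combT.
have hD := coindD (v z).2.
have h0 : (v z).2 0 = 0 by apply: (@addrI _ ((v z).2 0)); rewrite -hD !addr0.
change ((v z).2 (\sum_j kap (c j) * g j) = 0).
rewrite (big_morph _ hD h0) big1 // => j _.
by rewrite hK; have := z2 j; rewrite !ffunE => ->; rewrite scaler0.
Qed.

Lemma corner_pullback_finite_pdim : finite_pdim corner_pullback.
Proof.
apply: fin_pd_finite_pdim.
have sI := submodule_image unit_map.
apply: (fin_pd_extension (submoduleT _) sI (submodule0 _)) => //.
- by move=> _ ->; exists 0; rewrite linear0.
- apply: (fin_pd_cover (g := unit_map)) => //.
  + by move=> x; exists x.
  + by move=> _ [x <-]; exists x; rewrite subrr.
  apply: fin_pd_corner0 => //.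
  + exact: (submodule_preim unit_map (submodule0 _)).
  + exact: submodule0.
  + by move=> _ ->; rewrite linear0.
  (* The second component of [unit_map f] takes the value [e *: f] at 1. *)
  + move=> f /(congr1 val) /(congr1 snd) /(congr1 (fun h : coind F => h 1)) /=.
    by rewrite mulr1.
- apply: fin_pd_corner0 => //; first exact: corner_pullback_fdim.
  by move=> m _; exact: corner_unit_onto.
Qed.

End Pullback.

(** [T] identifies [e P] with [e Y], and [s] sends [y] to the element over [e *: y]. As [P] is
    projective over [G], [f \o T] lifts to a map [T'] into [F]; the second component of the lift of
    [f] at [y] sends [x] to [T' (s (x *: y))]. *)
Theorem corner_contravariantly_finite :
  contravariantly_finite (@fin_gen_finite_pdim G) (@fin_gen G).
Proof.
move=> M gM; have [n [m mS]] := gM.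
pose F := idem_sum (fun _ : 'I_n => 1 : G).
have oneK (i : 'I_n) : (1 : G) * 1 = 1 by rewrite mulr1.
pose pr : {linear F -> M} := @idem_lin G _ (fun _ : 'I_n => 1) M m.
have prS : surjective pr.
  move=> x; have [c ->] := mS x; exists (idem_of oneK c).
  by rewrite /pr idem_linE; apply: eq_bigr => i _; rewrite idem_ofE mulr1.
have pF : projective F by exact: idem_sum_projective.
have Ffd : fdim kap F by exact: (fin_gen_fdim Gfd (idem_sum_fin_gen oneK)).
have Mfd : fdim kap M by exact: fin_gen_fdim.
have plin : linear (fun z : corner_pullback pr => (val z).1) by move=> a x y.
exists (corner_pullback pr), (linear_of plin); split.
  split; first exact/fdim_fin_gen/corner_pullback_fdim.
  exact: corner_pullback_finite_pdim.
move=> Y f [gY dY]; have [P [T [pP Tinj Tsurj]]] := corner_cover gY dY.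
have [T' ET'] := pP _ _ pr (f \o T : {linear P -> M}) prS.
have /choice[s Es] : forall y, exists x, e *: x = x /\ T x = e *: y.
  by move=> y; have [x] := Tsurj y; exists x.
have sP y x : e *: x = x -> T x = e *: y -> s y = x.
  move=> ex Tx; apply/eqP; rewrite -subr_eq0; apply/eqP; apply: Tinj.
    by rewrite scalerBr (Es y).1 ex.
  by rewrite linearB (Es y).2 Tx subrr.
have sD y y' : s (y + y') = s y + s y'.
  by apply: sP; rewrite ?scalerDr ?linearD ?(Es y).1 ?(Es y').1 ?(Es y).2 ?(Es y').2.
have hadd y : (fun x => T' (s (x *: y))) \in @additive_pred G F.
  by apply/asboolP => a b; rewrite scalerDl sD linearD.
have memX y : corner_pullback_mem pr (f y, Coind (hadd y)).
  split=> [a x|x|x] /=.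
  - rewrite -linearZ; congr (T' _); apply: sP.
      by rewrite scalerA !mulrA eK.
    by rewrite linearZ /= (Es _).2 !scalerA !mulrA eK -(mulrA _ e e) eK.
  - congr (T' _); apply: sP; first exact: (Es _).1.
    by rewrite (Es _).2 !scalerA mulrA eK.
  - change (pr (T' (s (x *: y))) = (e * x) *: f y).
    by rewrite ET' /= (Es _).2 !linearZZ scalerA.
have glin : linear (fun y => to_submod (corner_pullback_submod pr) (memX y)).
  move=> a y y'; apply: val_inj; congr pair; first by rewrite /= linearP.
  apply: coindP => x.
  change (T' (s (x *: (a *: y + y'))) = T' (s ((x * a) *: y)) + T' (s (x *: y'))).
  by rewrite scalerDr scalerA sD linearD.
by exists (linear_of glin).
Qed.

End Approximation.

(** * Periodic exactness and corner projectivity *)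

Section FinitelySupported.
Variables (G : pzRingType) (P : lmodType G).

(** This leads to the free module on the underlying set of [P]; the projectives in a resolution need
    not be finitely generated. *)
Definition finsupp_mem (h : P -> G^o) : Prop :=
  exists s : seq P, forall t, t \notin s -> h t = 0.

Lemma finsupp_submod : is_submodule finsupp_mem.
Proof.
split=> [|a h k [s hs] [s' ks]]; first by exists [::].
exists (s ++ s') => t; rewrite mem_cat negb_or => /andP[ts ts'].
by rewrite !fctE hs // ks // addr0 scaler0.
Qed.

Definition finsupp_module : lmodType G := submod finsupp_submod.

Definition fs_val (h : finsupp_module) (t : P) : G := submod_incl finsupp_submod h t.

Lemma fs_valP a h k t : fs_val (a *: h + k) t = a * fs_val h t + fs_val k t.
Proof. by rewrite /fs_val linearP. Qed.

Lemma fs_valZ a h t : fs_val (a *: h) t = a * fs_val h t.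
Proof. by rewrite /fs_val linearZ. Qed.

Lemma fs_val0 t : fs_val 0 t = 0.
Proof. by rewrite /fs_val linear0. Qed.

Lemma fs_ext h k : (forall t, fs_val h t = fs_val k t) -> h = k.
Proof. by move=> E; apply: val_inj; apply/funext. Qed.

Definition fs_supp (h : finsupp_module) : seq P := sval (cid (submodP h)).

Lemma fs_suppP h t : t \notin fs_supp h -> fs_val h t = 0.
Proof. exact: svalP (cid (submodP h)) t. Qed.

Definition fs_sum (h : finsupp_module) : P :=
  \sum_(t <- undup (fs_supp h)) fs_val h t *: t.

(** The support list comes from a choice, so linearity needs independence of it: any two lists agree
    up to order on the entries where [h] is nonzero. *)
Lemma fs_sumE h (s : seq P) : uniq s -> (forall t, t \notin s -> fs_val h t = 0) ->
  fs_sum h = \sum_(t <- s) fs_val h t *: t.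
Proof.
have F s' : \sum_(t <- s') fs_val h t *: t =
    \sum_(t <- [seq t <- s' | fs_val h t != 0]) fs_val h t *: t.
  rewrite big_filter [RHS]big_mkcond /=; apply: eq_bigr => t _.
  by have [->|] := eqVneq (fs_val h t) 0; rewrite ?scale0r.
move=> us hs; rewrite /fs_sum [LHS]F [RHS]F; apply: perm_big; apply: uniq_perm.
- by rewrite filter_uniq ?undup_uniq.
- by rewrite filter_uniq.
move=> t; rewrite !mem_filter; case: eqP => //= h0.
rewrite mem_undup; have -> : t \in fs_supp h.
  by apply: contra_notT h0 => /fs_suppP.
by symmetry; apply: contra_notT h0 => /hs.
Qed.

Lemma fs_sum_linear : linear fs_sum.
Proof.
move=> a h k; pose s := undup (fs_supp h ++ fs_supp k).
have us : uniq s by exact: undup_uniq.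
have hs t : t \notin s -> fs_val h t = 0.
  by rewrite mem_undup mem_cat negb_or => /andP[/fs_suppP].
have ks t : t \notin s -> fs_val k t = 0.
  by rewrite mem_undup mem_cat negb_or => /andP[_ /fs_suppP].
rewrite (fs_sumE us hs) (fs_sumE us ks) (@fs_sumE _ s us) => [|t ts].
  rewrite scaler_sumr -big_split /=; apply: eq_bigr => t _.
  by rewrite fs_valP scalerDl scalerA.
by rewrite fs_valP hs // ks // mulr0 addr0.
Qed.

Lemma fs_sum_surjective : surjective fs_sum.
Proof.
move=> x; have dP : finsupp_mem (fun t => (t == x)%:R).
  by exists [:: x] => t; rewrite inE => /negbTE ->.
exists (to_submod finsupp_submod dP).
rewrite (@fs_sumE _ [:: x]) //= => [|t].
  by rewrite big_seq1 /fs_val /= eqxx scale1r.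
by rewrite inE /fs_val /= => /negbTE ->.
Qed.

End FinitelySupported.

(** * The alternating complex of [b] and [p] *)

Section Acyclicity.
Variables (K : fieldType) (G : pzRingType) (kap : {rmorphism K -> G}).
Hypothesis kapC : forall c x, kap c * x = x * kap c.
Variables e b p : G.
Hypotheses (eK : e * e = e) (eb : e * b = b) (be : b * e = b).
Hypotheses (ep : e * p = p) (pe : p * e = p) (pb : p * b = 0) (bp : b * p = 0).
Hypothesis b_nil : exists N, b ^+ N = 0.
Hypothesis ker_b : forall x, e * x = x -> b * x = 0 -> exists y, x = p * y.
Hypothesis ker_p : forall x, e * x = x -> p * x = 0 -> exists y, x = b * y.
Implicit Types M N P : lmodType G.

(* Exactness, on the submodule [U], of the complex in which multiplications by
   [b] and by [p] alternate. *)
Definition acyclic_on M (U : M -> Prop) : Prop :=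
  (forall z, U z -> e *: z = z -> b *: z = 0 -> exists2 y, U y & z = p *: y) /\
  (forall z, U z -> e *: z = z -> p *: z = 0 -> exists2 y, U y & z = b *: y).

Definition acyclic M := acyclic_on (fun _ : M => True).

Lemma finsupp_acyclic P : acyclic (finsupp_module P).
Proof.
have key (u v : G) : (forall x, e * x = x -> u * x = 0 -> exists y, x = v * y) ->
    forall z : finsupp_module P, e *: z = z -> u *: z = 0 -> exists2 y, True & z = v *: y.
  move=> H z ez uz.
  have /choice[y Ey] : forall t, exists y, fs_val z t = v * y.
    by move=> t; apply: H; rewrite -fs_valZ ?ez // uz fs_val0.
  (* Off the support the chosen [y t] need not vanish and is replaced by 0. *)
  have yP : finsupp_mem (fun t => if t \in fs_supp z then y t else 0).
    by exists (fs_supp z) => t /negbTE ->.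
  exists (to_submod (finsupp_submod P) yP) => //; apply: fs_ext => t.
  rewrite fs_valZ {2}/fs_val /=; case: ifPn => [_|/fs_suppP ->]; first exact: Ey.
  by rewrite mulr0.
by split=> z _; [exact: (key b p ker_b)|exact: (key p b ker_p)].
Qed.

(** A projective module is a retract of a free one, and exactness passes to retracts. *)
Lemma projective_acyclic P : projective P -> acyclic P.
Proof.
move=> pP.
have [h hK] := pP _ _ (linear_of (@fs_sum_linear G P)) (idfun : {linear P -> P})
  (@fs_sum_surjective G P).
have [A B] := finsupp_acyclic P.
have key (u v : G) : (forall z : finsupp_module P, True -> e *: z = z -> u *: z = 0 ->
      exists2 y, True & z = v *: y) ->
    forall z : P, True -> e *: z = z -> u *: z = 0 -> exists2 y, True & z = v *: y.
  move=> H z _ ez uz; have [||y _ Ey] := H (h z) I.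
  - by rewrite -linearZZ ez.
  - by rewrite -linearZZ uz linear0.
  exists (linear_of (@fs_sum_linear G P) y) => //.
  by rewrite -linearZZ -Ey hK.
by split; [exact: (key b p)|exact: (key p b)].
Qed.

(** Two out of three for a 2-periodic complex. If [b] kills [f x], then [b *: x] lies in the kernel
    of [f] and is killed by [p], so it is [b *: k] with [k] in that kernel; now [b] kills
    [e *: (x - k)], and exactness of [M] applies. *)
Lemma acyclic_image M N (f : {linear M -> N}) :
  acyclic M -> acyclic_on (fun x => f x = 0) ->
  acyclic_on (fun y => exists x, f x = y).
Proof.
move=> [AM BM] [AK BK]; split=> _ [x <-] ez uz.
  have [|||k fk Ek] := BK (b *: x).
  - by rewrite linearZZ.
  - by rewrite scalerA eb.
  - by rewrite scalerA pb scale0r.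
  have [||y _ Ey] := AM (e *: (x - k)) I.
  - by rewrite scalerA eK.
  - by rewrite scalerA be scalerBr Ek subrr.
  exists (f y); first by exists y.
  by rewrite -linearZZ -Ey linearZZ linearB fk subr0 ez.
have [|||k fk Ek] := AK (p *: x).
- by rewrite linearZZ.
- by rewrite scalerA ep.
- by rewrite scalerA bp scale0r.
have [||y _ Ey] := BM (e *: (x - k)) I.
- by rewrite scalerA eK.
- by rewrite scalerA pe scalerBr Ek subrr.
exists (f y); first by exists y.
by rewrite -linearZZ -Ey linearZZ linearB fk subr0 ez.
Qed.

(** Exactness climbs down the resolution: it is trivial for the images beyond the length, and each
    image inherits it from the preceding one. *)
Lemma acyclic_finite_pdim M : finite_pdim M -> acyclic M.
Proof.
move=> [n [P [d [f [pP fS ex0 exS P0]]]]].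
have imK (A B C : lmodType G) (u : {linear A -> B}) (w : {linear B -> C}) :
    exact_at u w -> acyclic_on (fun y => exists x, u x = y) ->
    acyclic_on (fun x => w x = 0).
  move=> uw; rewrite (_ : (fun y => exists x, u x = y) = (fun x => w x = 0)) //.
  by apply/funext => y; apply/propext; split=> /uw.
have step i : acyclic_on (fun y : P i => exists x, d i x = y).
  (* [k] measures how far degree [i] is from the range where the resolution vanishes. *)
  have [k Hk] : exists k, (n < i + k)%N by exists n.+1; rewrite addnS ltnS leq_addl.
  elim: k i Hk => [|k IHk] i Hk.
    rewrite addn0 in Hk.
    by split=> z [x <-] _ _; exists 0; rewrite ?scaler0;
      [exists 0; rewrite linear0|exact: P0|exists 0; rewrite linear0|exact: P0].
  have [leni|ltni] := leqP (n + 1) i.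
    by split=> z _ _ _; exists 0; rewrite ?scaler0;
      [exists 0; rewrite linear0|apply: P0; rewrite -addn1
      |exists 0; rewrite linear0|apply: P0; rewrite -addn1].
  apply: acyclic_image; first exact: projective_acyclic.
  by apply: (imK _ _ _ _ _ (exS i)); apply: IHk; rewrite addSnnS.
have [A B] : acyclic_on (fun y => exists x, f x = y).
  apply: acyclic_image; first exact: projective_acyclic.
  exact: (imK _ _ _ _ _ ex0).
by split=> z _ ez uz; [have [y _ ->] := A z (fS z) ez uz|have [y _ ->] := B z (fS z) ez uz];
  exists y.
Qed.

(** The basis is chosen among the given vectors, so that each basis vector stays at a single vertex
    and is hit by a summand [G * ev v]. [W] is only a [K]-subspace because it will be [b M], which
    need not be a [G]-submodule. *)
Lemma independent_modulo M (W : M -> Prop) (T : eqType) (val_of : T -> M) (s : seq T) :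
  W 0 -> (forall x y, W x -> W y -> W (x + y)) -> (forall c x, W x -> W (kap c *: x)) ->
  exists (I : finType) (q : I -> T),
    [/\ forall i, q i \in s,
        forall c, W (comb kap (val_of \o q) setT c) -> forall i, c i = 0 &
        forall t, t \in s -> exists c, W (val_of t - comb kap (val_of \o q) setT c)].
Proof.
move=> W0 WD WZ; elim: s => [|t s [I [q [qs qind qspan]]]].
  by exists void, (of_void T); split=> // [[]|c _ []].
have [ts|nts] := pselect (exists c, W (val_of t - comb kap (val_of \o q) setT c)).
  exists I, q; split=> // [i|t']; first by rewrite inE qs orbT.
  by rewrite inE => /orP[/eqP->|/qspan].
exists (unit + I)%type, (fun i => if i is inr i' then q i' else t).
have E c : comb kap (val_of \o (fun i : unit + I => if i is inr i' then q i' else t)) setT c =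
    kap (c (inl tt)) *: val_of t + comb kap (val_of \o q) setT (c \o inr).
  by rewrite !combT big_sumType /= (big_pred1 tt) //; case.
split=> [[_|i]|c|t'].
- exact: mem_head.
- by rewrite inE qs orbT.
- rewrite E => Wc; have c0 : c (inl tt) = 0.
    apply/eqP/negP => /negP c0; apply: nts.
    exists (fun i => - (c (inl tt))^-1 * c (inr i)).
    have := WZ (c (inl tt))^-1 _ Wc.
    rewrite scalerDr scalerA -rmorphM mulVf // rmorph1 scale1r combZ.
    have -> : comb kap (val_of \o q) [set: I] (fun i => - (c (inl tt))^-1 * c (inr i)) =
        - comb kap (val_of \o q) [set: I] (fun i => (c (inl tt))^-1 * (c \o inr) i).
      by rewrite /comb -sumrN; apply: eq_bigr => i _; rewrite mulNr rmorphN scaleNr.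
    by rewrite opprK.
  move: Wc; rewrite c0 rmorph0 scale0r add0r => /qind H [[]|i] //.
  exact: H.
rewrite inE => /orP[/eqP->|/qspan[c Wc]].
  exists (fun i => if i is inr _ then 0 else 1); rewrite E rmorph1 scale1r.
  rewrite [comb _ _ _ _]big1 ?addr0 ?subrr // => i _.
  by rewrite /= rmorph0 scale0r.
exists (fun i => if i is inr i' then c i' else 0).
by rewrite E rmorph0 scale0r add0r.
Qed.

Variables (V : finType) (R : pred V) (ev : V -> G).
Hypothesis evK : forall v, ev v * ev v = ev v.
Hypothesis eE : e = \sum_(v | R v) ev v.
Hypothesis corner_gen : forall v x, R v -> e * x = x -> x * ev v = x ->
  exists c y, x = kap c * ev v + b * y.

Lemma bX_e k : (0 < k)%N -> e * b ^+ k = b ^+ k.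
Proof. by case: k => // k _; rewrite exprS mulrA eb. Qed.

(** For injectivity, a power of [b] moves a nonzero [x] of the kernel to a nonzero element killed by
    [b], hence of the form [p *: (e *: y)]. Then [p] kills [T (e *: y)], which by exactness lies in
    [b M]; independence modulo [b M] removes the scalar parts of the coordinates of [e *: y], so it
    is a multiple of [b] and [p] kills it, a contradiction. *)
Lemma acyclic_corner_cover M : fdim kap M -> acyclic M ->
  exists (P : lmodType G) (T : {linear P -> M}),
    [/\ projective P, forall x, e *: x = x -> T x = 0 -> x = 0 &
        forall y, exists2 x, e *: x = x & T x = e *: y].
Proof.
move=> [I0 [z0 zS]] [_ BM].
pose W (x : M) := exists y, x = b *: y.
pose vl (t : V * I0) : M := ev t.1 *: z0 t.2.
pose s := [seq t <- enum {: V * I0} | R t.1].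
have [|x y [x' ->] [y' ->]|c x [y ->]|I [q [qs qind qspan]]] :=
  @independent_modulo M W _ vl s.
- by exists 0; rewrite scaler0.
- by exists (x' + y'); rewrite scalerDr.
- by exists (kap c *: y); rewrite (scale_kapC kapC).
have Rq i : R (q i).1 by have := qs i; rewrite mem_filter => /andP[].
pose eps i := ev (q i).1.
pose t i := vl (q i).
have epsK i : eps i * eps i = eps i by exact: evK.
have et i : eps i *: t i = t i by rewrite scalerA evK.
pose P := idem_sum eps.
pose T : {linear P -> M} := @idem_lin G _ eps M t.
have TE x : T x = \sum_i idem_coord x i *: t i by [].
have bT c : T (idem_of epsK (fun i => kap (c i))) = comb kap t setT c.
  by rewrite TE combT; apply: eq_bigr => i _; rewrite idem_ofE -scalerA et.
have span y : exists x y', e *: y = T x + b *: y'.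
  have [c ->] := zS y.
  have Ht j : exists x y', e *: z0 j = T x + b *: y'.
    have /choice[d Ed] : forall v, exists d, R v -> W (ev v *: z0 j - comb kap t setT d).
      move=> v; have [Rv|nRv] := boolP (R v); last by exists (fun=> 0).
      have [|d] := qspan (v, j); first by rewrite mem_filter Rv mem_enum.
      by exists d.
    have /choice[y' Ey'] : forall v, exists y',
        R v -> ev v *: z0 j = comb kap t setT (d v) + b *: y'.
      move=> v; have [Rv|nRv] := boolP (R v); last by exists 0.
      by have [y' Ey'] := Ed v Rv; exists y' => _; rewrite -Ey' addrC subrK.
    exists (\sum_(v | R v) idem_of epsK (fun i => kap (d v i))), (\sum_(v | R v) y' v).
    rewrite eE scaler_suml linear_sum scaler_sumr -big_split /=.
    by apply: eq_bigr => v Rv; rewrite (Ey' v Rv) -bT.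
  have /choice[x Ex] := Ht; have /choice[y' Ey'] := Ex.
  exists (\sum_j kap (c j) *: x j), (\sum_j kap (c j) *: y' j).
  have -> : T (\sum_j kap (c j) *: x j) = \sum_j kap (c j) *: T (x j).
    by rewrite linear_sum; apply: eq_bigr => j _; exact: linearZZ.
  rewrite combT !scaler_sumr -big_split; apply: eq_bigr => j _.
  by rewrite -(scale_kapC kapC) Ey' scalerDr (scale_kapC kapC _ b).
exists P, T; split=> [|x ex Tx|y].
- exact: idem_sum_projective.
- apply: contrapT => x0.
  have [N bN] := b_nil.
  have exm : exists m, b ^+ m *: x == 0 by exists N; rewrite bN scale0r.
  case: (ex_minnP exm) => -[|k]; first by rewrite expr0 scale1r => /eqP.
  move=> /eqP bk kmin.
  have bk0 : b ^+ k *: x <> 0 by move=> /eqP/kmin; rewrite ltnn.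
  have ez : e *: (b ^+ k *: x) = b ^+ k *: x.
    by case: k bk0 {bk kmin} => [|k] _; rewrite ?expr0 ?scale1r // scalerA bX_e.
  have [AP _] := projective_acyclic (idem_sum_projective epsK).
  have [|y _ Ey] := AP _ Logic.I ez; first by rewrite scalerA -exprS.
  have Ey' : b ^+ k *: x = p *: (e *: y) by rewrite scalerA pe.
  have [||u _ Eu] := BM (T (e *: y)) Logic.I.
  + by rewrite -linearZZ scalerA eK.
  + by rewrite -linearZZ -Ey' linearZZ Tx scaler0.
  have /choice[c Ec] : forall i, exists c, exists w,
      idem_coord (e *: y) i = kap c * eps i + b * w.
    move=> i; apply: corner_gen; first exact: Rq.
      by rewrite idem_coordZ mulrA eK.
    exact: idem_coordK.
  have /choice[w Ew] := Ec.
  have c0 : forall i, c i = 0.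
    apply: qind; exists (u - \sum_i w i *: t i).
    rewrite scalerBr -Eu TE scaler_sumr -sumrB combT; apply: eq_bigr => i _.
    by rewrite Ew scalerDl -scalerA et scalerA addrK.
  apply: bk0; rewrite Ey'.
  have -> : e *: y = b *: idem_of epsK w.
    apply: idem_coordP => i; rewrite [RHS]idem_coordZ idem_ofE mulrA.
    by rewrite -[LHS]idem_coordK Ew c0 rmorph0 mul0r add0r.
  by rewrite scalerA pb scale0r.
(* Nakayama's argument: iteration pushes the error term into a power of [b] that is zero. *)
have {}span k : exists x y', e *: y = T x + b ^+ k *: (e *: y').
  elim: k => [|k [x [y' Ey]]]; first by exists 0, y; rewrite linear0 add0r expr0 scale1r.
  have [x' [u Eu]] := span y'; exists (x + b ^+ k *: x'), u.
  by rewrite Ey Eu scalerDr linearD linearZZ addrA [in RHS]scalerA exprSr -mulrA be scalerA.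
have [N bN] := b_nil; have [x [y' Ey]] := span N.
exists (e *: x); first by rewrite scalerA eK.
by rewrite linearZZ -[T x]addr0 -(scale0r (e *: y')) -bN -Ey scalerA eK.
Qed.

End Acyclicity.

(** * Corners of serial algebras *)

Section Strings.
Variables (K : fieldType) (G : pzRingType) (kap : {rmorphism K -> G}).
Hypothesis kapC : forall c x, kap c * x = x * kap c.
Variables (V : finType) (ev : V -> G).
Hypothesis evK : forall v, ev v * ev v = ev v.
Hypothesis ev_orth : forall v w, v != w -> ev v * ev w = 0.
Hypothesis ev1 : \sum_v ev v = 1.
(** [Vc] delimits the vertices at which strings are considered: all of them for left modules, those
    on cycles for right modules. *)
Variables (Vc : V -> Prop) (R : pred V) (tau : V -> V) (lam : V -> nat) (t : G).
Hypothesis RVc : forall v, R v -> Vc v.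
Hypothesis tauVc : forall v, Vc v -> Vc (tau v).
Hypothesis t_tau : forall v, Vc v -> ev (tau v) * t * ev v = t * ev v.
Hypothesis lam_gt0 : forall v, Vc v -> (0 < lam v)%N.
Hypothesis t_lam : forall v i, Vc v -> (t ^+ i * ev v = 0) <-> (lam v <= i)%N.
Hypothesis t_gen : forall r v x, R r -> ev r * x = x -> x * ev v = x -> x <> 0 ->
  Vc v /\ exists c : nat -> K, x = \sum_(i < lam v) kap (c i) * (t ^+ i * ev v).
(* A string starting at [v] has letters [iter i tau v], [i < lam v].  The
   letters between the end of the string of [v] and the end of the string of
   [tau v] decide whether [v] lies in [R]. *)
Hypothesis R_out : forall v j, Vc v -> ~~ R v -> (lam v <= j)%N ->
  (j < (lam (tau v)).+1)%N -> ~~ R (iter j tau v).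
Hypothesis R_in : forall v, R v -> exists2 j, (lam v <= j < (lam (tau v)).+1)%N &
  R (iter j tau v).

Definition corner_idem : G := \sum_(v | R v) ev v.
Local Notation e := corner_idem.

Lemma corner_ev r : R r -> e * ev r = ev r.
Proof.
move=> Rr; rewrite mulr_suml (bigD1 r) //= evK big1 ?addr0 // => v /andP[_ vr].
exact: ev_orth.
Qed.

Lemma ev_corner r : R r -> ev r * e = ev r.
Proof.
move=> Rr; rewrite mulr_sumr (bigD1 r) //= evK big1 ?addr0 // => v /andP[_ vr].
by apply: ev_orth; rewrite eq_sym.
Qed.

Lemma corner_idemK : e * e = e.
Proof. by rewrite {2}/e mulr_sumr; apply: eq_bigr => r; exact: corner_ev. Qed.

Lemma iter_Vc i v : Vc v -> Vc (iter i tau v).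
Proof. by move=> Vv; elim: i => //= i; exact: tauVc. Qed.

Lemma t_iter i v : Vc v -> ev (iter i tau v) * (t ^+ i * ev v) = t ^+ i * ev v.
Proof.
move=> Vv; elim: i => [|i IHi]; first by rewrite expr0 mul1r evK.
rewrite exprS -mulrA -IHi /= !mulrA -(mulrA _ t) -(mulrA _ (t * _)) ?mulrA.
by rewrite t_tau //; exact: iter_Vc.
Qed.

(** Counted from [v], the string of a later letter ends no earlier; the comparisons of ends below
    rest on this. *)
Lemma lam_iter i v : Vc v -> (lam v <= lam (iter i tau v) + i)%N.
Proof.
move=> Vv; apply/t_lam => //; rewrite exprD -mulrA -t_iter // mulrA.
have -> : t ^+ lam (iter i tau v) * ev (iter i tau v) = 0.
  by apply/t_lam => //; exact: iter_Vc.
by rewrite mul0r.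
Qed.

(** If no later letter of the string lies in [R], [find] returns [lam r], and [t ^+ next r * ev r]
    vanishes without a case distinction. *)
Definition next (r : V) : nat :=
  find (fun k => (0 < k)%N && R (iter k tau r)) (iota 0 (lam r)).

Lemma next_min r k : (0 < k < lam r)%N -> R (iter k tau r) -> (next r <= k)%N.
Proof.
move=> /andP[k0 kr] Rk; rewrite leqNgt; apply/negP => lt.
have := before_find 0%N lt; rewrite nth_iota //.
by rewrite add0n k0 Rk.
Qed.

Lemma nextP r : (next r < lam r)%N -> (0 < next r)%N /\ R (iter (next r) tau r).
Proof.
rewrite -[X in (_ < X)%N](size_iota 0) -has_find => H.
have := nth_find 0%N H; rewrite nth_iota; first by move=> /andP.
by rewrite -[X in (_ < X)%N](size_iota 0) -has_find.
Qed.

(* [step] moves a letter in [R] to the next one of its string, and [costep] below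
   moves it to the last one. *)
Definition step : G := \sum_(r | R r) t ^+ next r * ev r.
Local Notation b := step.

Lemma step_ev r : R r -> b * ev r = t ^+ next r * ev r.
Proof.
move=> Rr; rewrite mulr_suml (bigD1 r) //= -mulrA evK big1 ?addr0 // => v /andP[_ vr].
by rewrite -mulrA ev_orth // mulr0.
Qed.

Lemma step_corner : b * e = b.
Proof. by rewrite mulr_sumr; apply: eq_bigr => r; exact: step_ev. Qed.

Lemma corner_step : e * b = b.
Proof.
rewrite mulr_sumr; apply: eq_bigr => r Rr.
have [lt|ge] := ltnP (next r) (lam r).
  by rewrite -t_iter ?mulrA ?corner_ev //; [exact: (nextP lt).2|exact: RVc].
by rewrite (t_lam _ (RVc Rr)).2 // mulr0.
Qed.

Lemma step_pos v q : Vc v -> R (iter q tau v) ->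
  b * (t ^+ q * ev v) = t ^+ (next (iter q tau v) + q) * ev v.
Proof.
move=> Vv Rq; rewrite -{1}t_iter // mulrA step_ev // -mulrA t_iter //.
by rewrite exprD mulrA.
Qed.

Lemma step_exp n r : R r -> b ^+ n * ev r <> 0 ->
  exists j, [/\ b ^+ n * ev r = t ^+ j * ev r, (j < lam r)%N, R (iter j tau r) & (n <= j)%N].
Proof.
move=> Rr; have Vr := RVc Rr; elim: n => [|n IHn] nz.
  by exists 0%N; rewrite !expr0 lam_gt0.
have [|j [Ej jr Rj nj]] := IHn.
  by apply: contra_not nz; rewrite exprS -mulrA => ->; rewrite mulr0.
move: nz; rewrite exprS -mulrA Ej step_pos //; set s := iter j tau r => nz.
have Vs : Vc s by exact: iter_Vc.
have lt : (next s < lam s)%N.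
  rewrite ltnNge; apply: contra_notN nz => ge.
  apply/t_lam => //; apply: leq_trans (lam_iter j Vr) _.
  by rewrite leq_add2r.
have [n0 Rn] := nextP lt.
exists (next s + j)%N; split=> //.
- by rewrite ltnNge; apply: contra_notN nz => /t_lam ->.
- by rewrite iterD.
- by rewrite -add1n leq_add.
Qed.

Lemma step_nil : exists N, b ^+ N = 0.
Proof.
exists (\sum_v lam v).+1.
rewrite exprSr -[X in _ * X]step_corner mulrA -exprSr mulr_sumr big1 // => r Rr.
apply: contrapT => /(step_exp Rr)[j [_ jr _]].
rewrite ltnNge => /negP; apply; apply: leq_trans (ltnW jr) _.
by rewrite (bigD1 r) //= leq_addr.
Qed.

Lemma last_ex r : exists n, R r -> b ^+ n.+1 * ev r = 0 /\ b ^+ n * ev r <> 0.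
Proof.
have [Rr|nRr] := boolP (R r); last by exists 0%N.
have ex : exists n, b ^+ n.+1 * ev r == 0.
  by have [N N0] := step_nil; exists N; rewrite exprS N0 mulr0 mul0r.
case: (ex_minnP ex) => n /eqP En nmin; exists n => _; split=> //.
case: n En nmin => [|n] _ nmin; last by move=> /eqP/nmin; rewrite ltnn.
move=> H; have /(t_lam 0 (RVc Rr)) := H; rewrite leqn0 => /eqP lr.
by have := lam_gt0 (RVc Rr); rewrite lr.
Qed.

Definition last_step (r : V) : nat := sval (cid (last_ex r)).

Lemma last_stepP r : R r ->
  b ^+ (last_step r).+1 * ev r = 0 /\
  exists j, [/\ b ^+ last_step r * ev r = t ^+ j * ev r, (j < lam r)%N,
    R (iter j tau r) & forall i, (i < lam r)%N -> R (iter i tau r) -> (i <= j)%N].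
Proof.
move=> Rr; have Vr := RVc Rr; have [E0 nz] := svalP (cid (last_ex r)) Rr.
split=> //; have [j [Ej jr Rj _]] := step_exp Rr nz; exists j; split=> // i ir Ri.
rewrite leqNgt; apply/negP => ji.
move: E0; rewrite exprS -mulrA Ej step_pos // => /t_lam - /(_ Vr).
rewrite leqNgt => /negP; apply; apply: leq_ltn_trans (ir).
suff : (next (iter j tau r) <= i - j)%N by lia.
apply: next_min; last by rewrite -iterD subnK // ltnW.
have := lam_iter j Vr; move: ji ir; clear; lia.
Qed.

Definition costep : G := \sum_(r | R r) b ^+ last_step r * ev r.
Local Notation p := costep.

Lemma costep_ev r : R r -> p * ev r = b ^+ last_step r * ev r.
Proof.
move=> Rr; rewrite mulr_suml (bigD1 r) //= -mulrA evK big1 ?addr0 // => v /andP[_ vr].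
by rewrite -mulrA ev_orth // mulr0.
Qed.

Lemma costep_corner : p * e = p.
Proof. by rewrite mulr_sumr; apply: eq_bigr => r; exact: costep_ev. Qed.

Lemma corner_stepX n r : R r -> e * (b ^+ n * ev r) = b ^+ n * ev r.
Proof.
move=> Rr; case: n => [|n]; first by rewrite expr0 mul1r corner_ev.
by rewrite exprS -mulrA mulrA corner_step.
Qed.

Lemma corner_costep : e * p = p.
Proof. by rewrite mulr_sumr; apply: eq_bigr => r; exact: corner_stepX. Qed.

Lemma step_costep : b * p = 0.
Proof.
rewrite mulr_sumr big1 // => r Rr; rewrite mulrA -exprS.
exact: (last_stepP Rr).1.
Qed.

(** By [R_in] the overhang of [r] contains a letter of [R]. It still belongs to the string of the
    letter reached by one step, so the last letter reached from there lies beyond the end of the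
    string of [r]. *)
Lemma costep_step : p * b = 0.
Proof.
rewrite mulr_sumr big1 // => r Rr; have Vr := RVc Rr.
have [lt|ge] := ltnP (next r) (lam r); last by rewrite (t_lam _ Vr).2 // mulr0.
have [k0 Rk] := nextP lt; set k := next r in lt k0 Rk *; set s := iter k tau r in Rk.
have [_ [j [Ej js Rj jmax]]] := last_stepP Rk.
rewrite -t_iter // mulrA costep_ev // Ej -mulrA t_iter // mulrA -exprD.
apply/t_lam => //; have [i /andP[ri ir] Ri] := R_in Rr.
have ki : (k <= i)%N by apply: leq_trans ri; exact: ltnW.
suff : (i - k <= j)%N by lia.
apply: jmax; last by rewrite -iterD subnK.
by have := lam_iter k.-1 (tauVc Vr); rewrite -iterSr prednK // -/s => H; lia.
Qed.

Lemma step_reach v q i : Vc v -> (q <= i)%N -> (i < lam v)%N -> R (iter q tau v) ->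
  R (iter i tau v) -> exists m, t ^+ i * ev v = b ^+ m * (t ^+ q * ev v).
Proof.
move=> Vv; move En: (i - q)%N => n; elim/ltn_ind: n q En => n IHn q En qi iv Rq Ri.
have [->|nqi] := eqVneq i q; first by exists 0%N; rewrite expr0 mul1r.
have lt : (q < i)%N by rewrite ltn_neqAle eq_sym nqi.
set s := iter q tau v in Rq *.
have sE : iter (i - q) tau s = iter i tau v by rewrite -iterD subnK.
have iqs : (i - q < lam s)%N.
  by rewrite ltn_subLR // addnC; exact: leq_trans iv (lam_iter q Vv).
have nle : (next s <= i - q)%N by apply: next_min; rewrite ?subn_gt0 ?lt ?sE.
have [n0 Rn] := nextP (leq_ltn_trans nle iqs).
have Rq' : R (iter (next s + q) tau v) by rewrite iterD.
have H1 : (i - (next s + q) < n)%N by rewrite -En; move: n0 nle lt; clear; lia.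
have H2 : (next s + q <= i)%N by move: nle lt; clear; lia.
have [m Em] := IHn _ H1 _ erefl H2 iv Rq' Ri.
by exists m.+1; rewrite Em -step_pos // exprSr mulrA.
Qed.

(** All letters in [R] of the string of [v] are reached by steps from the first one, at position
    [f]; hence modulo multiples of [b] only that letter remains. *)
Lemma corner_decomposition v f x : Vc v -> R (iter f tau v) ->
  (forall i, (i < f)%N -> ~~ R (iter i tau v)) -> e * x = x -> x * ev v = x ->
  exists c y, [/\ x = kap c * (t ^+ f * ev v) + b * y, e * y = y & y * ev v = y].
Proof.
move=> Vv Rf fmin ex xv.
pose Q x := exists c y, [/\ x = kap c * (t ^+ f * ev v) + b * y, e * y = y & y * ev v = y].
rewrite -/(Q x).
have Q0 : Q 0 by exists 0, 0; rewrite rmorph0 !(mul0r, mulr0) addr0.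
have QD x1 x2 : Q x1 -> Q x2 -> Q (x1 + x2).
  move=> [c [y [-> ey yv]]] [d [z [-> ez zv]]]; exists (c + d), (y + z).
  by rewrite rmorphD !mulrDl !mulrDr addrACA ey ez yv zv.
have QZ a x1 : Q x1 -> Q (kap a * x1).
  move=> [c [y [-> ey yv]]]; exists (a * c), (kap a * y).
  rewrite rmorphM mulrDr !mulrA; split; rewrite -?mulrA ?yv //.
    by rewrite (mulrA b) -(kapC a b) -!mulrA.
  by rewrite mulrA -kapC -mulrA ey.
rewrite -ex mulr_suml; apply: (big_ind Q) => // r Rr.
have [E0|nz] := pselect (ev r * x = 0); first by rewrite E0.
have rx : ev r * (ev r * x) = ev r * x by rewrite mulrA evK.
have rxv : ev r * x * ev v = ev r * x by rewrite -mulrA xv.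
have [_ [c Ec]] := t_gen Rr rx rxv nz.
rewrite -[ev r]evK -mulrA Ec mulr_sumr; apply: (big_ind Q) => // i _.
rewrite mulrA -kapC -mulrA; apply: QZ; rewrite -t_iter // mulrA.
have [ri|ri] := eqVneq r (iter i tau v); last by rewrite ev_orth // mul0r.
rewrite ri evK t_iter //; rewrite ri in Rr.
have [|m ->] := @step_reach v f i Vv _ (ltn_ord i) Rf Rr.
  by rewrite leqNgt; apply/negP => /fmin; rewrite Rr.
have wv : t ^+ f * ev v * ev v = t ^+ f * ev v by rewrite -mulrA evK.
case: m => [|m].
  by rewrite expr0 mul1r; exists 1, 0; rewrite rmorph1 !(mul0r, mulr0) mul1r addr0.
exists 0, (b ^+ m * (t ^+ f * ev v)); split.
- by rewrite rmorph0 mul0r add0r exprS -(mulrA b).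
- by rewrite -{1}(t_iter f Vv) (mulrA (b ^+ m)) (mulrA e) corner_stepX // -mulrA t_iter.
- by rewrite -mulrA wv.
Qed.

Lemma corner_string v x : e * x = x -> x * ev v = x -> x <> 0 ->
  Vc v /\ exists f, [/\ R (iter f tau v), (f < lam v)%N &
    forall i, (i < f)%N -> ~~ R (iter i tau v)].
Proof.
move=> ex xv nz.
have [r Rr nzr] : exists2 r, R r & ev r * x <> 0.
  apply: contrapT => H; apply: nz; rewrite -ex mulr_suml big1 // => r Rr.
  by apply: contrapT => nzr; apply: H; exists r.
have rx : ev r * (ev r * x) = ev r * x by rewrite mulrA evK.
have rxv : ev r * x * ev v = ev r * x by rewrite -mulrA xv.
have [Vv [c Ec]] := t_gen Rr rx rxv nzr; split=> //.
have ex_pos : exists i, (i < lam v)%N && R (iter i tau v).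
  apply: contrapT => /forallNP H; apply: nzr; rewrite -rx Ec mulr_sumr big1 // => i _.
  have [ri|ri] := eqVneq r (iter i tau v).
    by have := H i; rewrite ltn_ord -ri Rr.
  by rewrite mulrA -kapC -mulrA -t_iter // (mulrA (ev r)) ev_orth // mul0r mulr0.
case: (ex_minnP ex_pos) => f /andP[fv Rf] fmin; exists f; split=> // i lt.
apply/negP => Ri; have := fmin i; rewrite Ri (ltn_trans lt fv) => /(_ isT).
by rewrite leqNgt lt.
Qed.

(** * Exactness on a single string *)

Section OneString.
Variables (v : V) (f : nat).
Hypotheses (Vv : Vc v) (Rf : R (iter f tau v)) (fv : (f < lam v)%N).
Hypothesis fmin : forall i, (i < f)%N -> ~~ R (iter i tau v).
Let w := t ^+ f * ev v.
Let n := last_step (iter f tau v).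

Lemma string_costep : p * w = b ^+ n * w.
Proof. by rewrite /w /n -t_iter // mulrA costep_ev // -mulrA. Qed.

(** By [R_out] the overhangs of the letters before position [f] contain nothing of [R], so the last
    letter in [R] of the string of [iter f tau v] is not cut off in the shorter string of [v]. *)
Lemma string_costep_neq0 : p * w <> 0.
Proof.
have [_ [j [Ej jr Rj _]]] := last_stepP Rf.
rewrite /w -t_iter // mulrA costep_ev // Ej -mulrA t_iter // mulrA -exprD.
move=> /t_lam - /(_ Vv) lvj.
(* Position [j + f], counted from [v], belongs to the string of the [m]-th letter; descending
   induction from [m = f] to [m = 0]. *)
have cover m : (m <= f)%N -> (j + f < m + lam (iter m tau v))%N.
  move=> mf; rewrite -(subKn mf); elim: (f - m)%N (leq_subr m f) => [|k IHk] kf.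
    by rewrite subn0 (addnC j) ltn_add2l.
  have lt := IHk (ltnW kf); set m' := (f - k.+1)%N.
  have Em : (f - k)%N = m'.+1 by rewrite /m'; lia.
  rewrite ltnNge; apply/negP => ge.
  have Vm : Vc (iter m' tau v) by exact: iter_Vc.
  have mf' : (m' < f)%N by rewrite /m'; lia.
  have g1 : (lam (iter m' tau v) <= j + f - m')%N by move: ge mf'; clear; lia.
  have g2 : (j + f - m' < (lam (tau (iter m' tau v))).+1)%N.
    by move: lt; rewrite Em /=; move: mf'; clear; lia.
  have /negP := R_out Vm (fmin mf') g1 g2; apply.
  by rewrite -iterD subnK ?iterD //; move: mf'; clear; lia.
by have := cover 0%N isT; rewrite add0n ltnNge lvj.
Qed.

(** [b ^+ n.+1] kills [w], so the decomposition replaces [x] by [b * y]; repetition produces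
    arbitrarily high powers of the nilpotent [b]. *)
Lemma string_stepX x : e * x = x -> x * ev v = x -> b ^+ n.+1 * x = 0.
Proof.
have H k : forall x, e * x = x -> x * ev v = x ->
    exists2 y, [/\ e * y = y & y * ev v = y] & b ^+ n.+1 * x = b ^+ k * (b ^+ n.+1 * y).
  elim: k => [|k IHk] {}x ex xv; first by exists x; rewrite // expr0 mul1r.
  have [c [y [-> ey yv]]] := corner_decomposition Vv Rf fmin ex xv.
  have [z [ez zv] Ez] := IHk y ey yv; exists z => //.
  rewrite mulrDr mulrA -kapC -mulrA -t_iter // (mulrA (b ^+ n.+1)).
  rewrite (last_stepP Rf).1 mul0r mulr0 add0r.
  by rewrite mulrA -exprSr exprS -mulrA Ez mulrA -exprS.
move=> ex xv; have [N N0] := step_nil.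
by have [y _ ->] := H N x ex xv; rewrite N0 mul0r.
Qed.

(** [x] is divided by [b] as often as [n] times: each time the coefficient of [w] must vanish, since
    [b ^+ n * w] is nonzero while [b * x = 0]. After [n] divisions only a multiple of
    [b ^+ n * w = p * w] is left. *)
Lemma string_ker_step x : e * x = x -> x * ev v = x -> b * x = 0 -> exists y, x = p * y.
Proof.
move=> ex xv bx.
have H k : (k <= n)%N -> exists2 y, [/\ e * y = y & y * ev v = y] & x = b ^+ k * y.
  elim: k => [|k IHk] kn; first by exists x; rewrite // expr0 mul1r.
  have [y [ey yv] Ey] := IHk (ltnW kn).
  have [c [z [Ez ez zv]]] := corner_decomposition Vv Rf fmin ey yv.
  have : b ^+ n * y = 0.
    have -> : b ^+ n * y = b ^+ (n - k.+1) * (b * x).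
      rewrite Ey !mulrA -exprSr -exprD; congr (b ^+ _ * _).
      by move: kn; clear; lia.
    by rewrite bx mulr0.
  rewrite Ez mulrDr mulrA -kapC -mulrA -/w -string_costep (mulrA _ b) -exprSr.
  rewrite string_stepX // addr0 => Ec.
  have c0 : c = 0.
    apply/eqP/negP => /negP c0; apply: string_costep_neq0.
    by rewrite -[p * w]mul1r -(rmorph1 kap) -(mulVf c0) rmorphM -mulrA Ec mulr0.
  by exists z => //; rewrite Ey Ez c0 rmorph0 mul0r add0r mulrA -exprSr.
have [y [ey yv] Ey] := H n (leqnn n).
have [c [z [Ez ez zv]]] := corner_decomposition Vv Rf fmin ey yv.
exists (kap c * w); rewrite Ey Ez mulrDr (mulrA (b ^+ n) b) -exprSr string_stepX // addr0.
by rewrite mulrA -kapC -mulrA -/w -string_costep mulrA kapC mulrA.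
Qed.

Lemma string_ker_costep x : e * x = x -> x * ev v = x -> p * x = 0 -> exists y, x = b * y.
Proof.
move=> ex xv; have [c [z [-> ez zv]]] := corner_decomposition Vv Rf fmin ex xv.
rewrite mulrDr (mulrA p b) costep_step mul0r addr0 mulrA -kapC -mulrA -/w => Ec.
have c0 : c = 0.
  apply/eqP/negP => /negP c0; apply: string_costep_neq0.
  by rewrite -[p * w]mul1r -(rmorph1 kap) -(mulVf c0) rmorphM -mulrA Ec mulr0.
by exists z; rewrite c0 rmorph0 mul0r add0r.
Qed.

End OneString.

(** Right multiplication by [ev v] commutes with left multiplications, so exactness can be tested
    string by string. *)
Lemma split_right (u u' : G) :
  (forall v x, e * x = x -> x * ev v = x -> u * x = 0 -> x <> 0 -> exists y, x = u' * y) ->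
  forall x, e * x = x -> u * x = 0 -> exists y, x = u' * y.
Proof.
move=> H x ex ux.
have /choice[y Ey] : forall v, exists y, x * ev v = u' * y.
  move=> v; have [->|nz] := pselect (x * ev v = 0); first by exists 0; rewrite mulr0.
  by apply: (H v) => //; rewrite ?mulrA ?ex ?ux ?mul0r // -mulrA evK.
by exists (\sum_v y v); rewrite -[x]mulr1 -ev1 !mulr_sumr; apply: eq_bigr => v _.
Qed.

Lemma ker_step x : e * x = x -> b * x = 0 -> exists y, x = p * y.
Proof.
apply: split_right => {}x v ex xv bx /(corner_string ex xv)[Vv [f [Rf fv fmin]]].
exact: (string_ker_step Vv Rf fv).
Qed.

Lemma ker_costep x : e * x = x -> p * x = 0 -> exists y, x = b * y.
Proof.
apply: split_right => {}x v ex xv bx /(corner_string ex xv)[Vv [f [Rf fv fmin]]].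
exact: (string_ker_costep Vv Rf fv).
Qed.

Lemma corner_generation v x : R v -> e * x = x -> x * ev v = x ->
  exists c y, x = kap c * ev v + b * y.
Proof.
move=> Rv ex xv; have [|c [y [-> _ _]]] := @corner_decomposition v 0%N x (RVc Rv) Rv _ ex xv.
  by [].
by exists c, y; rewrite expr0 mul1r.
Qed.

Lemma string_corner_cover (Y : lmodType G) : fdim kap G^o -> fin_gen Y -> finite_pdim Y ->
  exists (P : lmodType G) (T : {linear P -> Y}),
    [/\ projective P, forall x, e *: x = x -> T x = 0 -> x = 0 &
        forall y, exists2 x, e *: x = x & T x = e *: y].
Proof.
move=> Gfd gY dY.
apply: (acyclic_corner_cover kapC corner_idemK corner_step step_corner costep_corner
  costep_step step_nil ker_step ker_costep evK (erefl e) corner_generation).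
  exact: fin_gen_fdim.
exact: (acyclic_finite_pdim corner_idemK corner_step step_corner corner_costep
  costep_corner costep_step step_costep ker_step ker_costep).
Qed.

End Strings.

(** * The criterion common to left and right modules *)

Section SerialCriterion.
Variables (K : fieldType) (G : pzRingType) (kap : {rmorphism K -> G}).
Hypothesis kapC : forall c x, kap c * x = x * kap c.
Hypothesis Gfd : fdim kap G^o.
Variables (V A : finType) (ev : V -> G) (al : A -> G) (so ta : A -> V).
Hypothesis evK : forall v, ev v * ev v = ev v.
Hypothesis ev_orth : forall v w, v != w -> ev v * ev w = 0.
Hypothesis ev1 : \sum_v ev v = 1.
Hypothesis al_so : forall a, al a * ev (so a) = al a.
Hypothesis al_ta : forall a, ev (ta a) * al a = al a.
Hypothesis al_gen : forall x, exists c h,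
  x = \sum_v kap (c v) * ev v + \sum_a h a * al a.
Hypothesis al_nil : exists N, forall s : seq A, size s = N -> \prod_(a <- s) al a = 0.
Variable below : V -> V -> Prop.
Hypothesis belowP : forall x v (h : A -> G),
  (forall a, ev v * h a = h a) ->
  (forall a, h a * (if so a == x then ev (ta a) else 0) = h a) ->
  \sum_a h a * al a = 0 -> (exists a, h a <> 0) -> below x v.

(* The vertices whose simple module may have infinite projective dimension. *)
Definition recurrent (v : V) : bool := `[< ~ Acc (fun v w => below w v) v >].

Lemma recurrentPn v : ~~ recurrent v -> Acc (fun v w => below w v) v.
Proof. by move=> /asboolPn/contrapT. Qed.

Lemma recurrent_below v w : ~~ recurrent v -> below v w -> ~~ recurrent w.
Proof.
move=> /recurrentPn av vw; apply/asboolPn; apply; exact: Acc_inv av _ vw.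
Qed.

Lemma recurrent_step v : recurrent v -> exists2 w, below v w & recurrent w.
Proof.
move=> /asboolP nav; apply: contrapT => H; apply: nav; constructor=> w vw.
by apply: recurrentPn; apply/negP => Rw; apply: H; exists w.
Qed.

Variables (Vc : V -> Prop) (tau : V -> V) (lam : V -> nat) (t : G).
Local Notation R := recurrent.
Hypothesis RVc : forall v, R v -> Vc v.
Hypothesis tauVc : forall v, Vc v -> Vc (tau v).
Hypothesis t_tau : forall v, Vc v -> ev (tau v) * t * ev v = t * ev v.
Hypothesis lam_gt0 : forall v, Vc v -> (0 < lam v)%N.
Hypothesis t_lam : forall v i, Vc v -> (t ^+ i * ev v = 0) <-> (lam v <= i)%N.
Hypothesis t_gen : forall r v x, R r -> ev r * x = x -> x * ev v = x -> x <> 0 ->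
  Vc v /\ exists c : nat -> K, x = \sum_(i < lam v) kap (c i) * (t ^+ i * ev v).
Hypothesis R_out : forall v j, Vc v -> ~~ R v -> (lam v <= j)%N ->
  (j < (lam (tau v)).+1)%N -> ~~ R (iter j tau v).
Hypothesis R_in : forall v, R v -> exists2 j, (lam v <= j < (lam (tau v)).+1)%N &
  R (iter j tau v).

Theorem serial_contravariantly_finite :
  contravariantly_finite (@fin_gen_finite_pdim G) (@fin_gen G).
Proof.
pose e := corner_idem ev R.
apply: (@corner_contravariantly_finite _ _ _ kapC Gfd e).
- exact: corner_idemK.
- move=> M W U Mfd sW sU UW eW.
  apply: (fin_pd_filtration_fdim kapC evK ev_orth ev1 al_ta al_gen al_nil) => // v.
  have [Rv|/recurrentPn av] := boolP (R v); last first.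
    left; exact: (good_vertexP kapC Gfd evK ev_orth ev1 al_so al_ta al_gen al_nil belowP).
  right=> m Wm; have -> : ev v *: m = ev v *: (e *: m) by rewrite scalerA ev_corner.
  by apply: submoduleZ => //; exact: eW.
- move=> Y gY dY.
  exact: (string_corner_cover kapC evK ev_orth ev1 RVc tauVc t_tau lam_gt0 t_lam t_gen
    R_out R_in Gfd gY dY).
Qed.

End SerialCriterion.

Lemma converse_monoid_morphism (K : comPzRingType) (G : pzRingType)
  (f : {rmorphism K -> G}) : monoid_morphism (f : K -> G^c).
Proof.
split=> [|c d]; first exact (rmorph1 f).
rewrite (mulrC c d); exact (rmorphM f d c).
Qed.

Definition converse_rmorphism (K : comPzRingType) (G : pzRingType)
    (f : {rmorphism K -> G}) : {rmorphism K -> G^c} :=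
  HB.pack (f : K -> G^c)
    (GRing.isZmodMorphism.Build K G^c (f : K -> G^c) (raddfB f))
    (GRing.isMonoidMorphism.Build K G^c (f : K -> G^c) (converse_monoid_morphism f)).

(** * Generation by vertices and arrows *)

Section VertexArrowCombinations.
Variables (K : fieldType) (G : pzRingType) (kap : {rmorphism K -> G}).
Variables (V A : finType) (ev : V -> G) (al : A -> G).

Definition vertex_arrow_comb (x : G) : Prop :=
  exists (c : V -> K) (h : A -> G),
    x = \sum_v kap (c v) * ev v + \sum_a h a * al a.

Lemma vertex_arrow_comb0 : vertex_arrow_comb 0.
Proof.
exists (fun=> 0), (fun=> 0); rewrite !big1 ?addr0 // => i _; first by rewrite mul0r.
by rewrite rmorph0 mul0r.
Qed.

Lemma vertex_arrow_combD x y :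
  vertex_arrow_comb x -> vertex_arrow_comb y -> vertex_arrow_comb (x + y).
Proof.
move=> [c [h ->]] [d [k ->]]; exists (fun v => c v + d v), (fun a => h a + k a).
rewrite addrACA -!big_split; congr (_ + _); apply: eq_bigr => i _ /=.
  by rewrite rmorphD mulrDl.
by rewrite mulrDl.
Qed.

Lemma vertex_arrow_combZ c x : vertex_arrow_comb x -> vertex_arrow_comb (kap c * x).
Proof.
move=> [d [h ->]]; exists (fun v => c * d v), (fun a => kap c * h a).
rewrite mulrDr !mulr_sumr; congr (_ + _); apply: eq_bigr => i _.
  by rewrite rmorphM mulrA.
by rewrite mulrA.
Qed.

Lemma vertex_arrow_comb_vertex v : vertex_arrow_comb (ev v).
Proof.
exists (fun w => (w == v)%:R), (fun=> 0); rewrite (bigD1 v) //= eqxx rmorph1 mul1r.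
rewrite !big1 ?addr0 // => [a _|w /negbTE ->]; first by rewrite mul0r.
by rewrite rmorph0 mul0r.
Qed.

Lemma vertex_arrow_comb_arrow x a : vertex_arrow_comb (x * al a).
Proof.
exists (fun=> 0), (fun a' => if a' == a then x else 0).
rewrite big1 => [|v _]; last by rewrite rmorph0 mul0r.
rewrite add0r (bigD1 a) //= eqxx big1 ?addr0 // => a' /negbTE ->.
by rewrite mul0r.
Qed.

(** A geometric series: after division by [c] the element is [1 - n] cut by [e], with [n]
    nilpotent. *)
Lemma idem_left_inverse (e x : G) c m : c != 0 -> x * e = x ->
  (- kap c^-1 * x) ^+ m = 0 -> exists y, y * (kap c * e + x) = e.
Proof.
move=> c0 xe; set n := - kap c^-1 * x => n0.
have E : kap c^-1 * (kap c * e + x) = (1 - n) * e.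
  rewrite mulrDr mulrA -rmorphM mulVf // rmorph1 mul1r.
  by rewrite mulrBl mul1r /n !mulNr opprK -mulrA xe.
exists ((\sum_(i < m) n ^+ i) * kap c^-1).
rewrite -mulrA E mulrA; have <- : 1 - n ^+ m = (\sum_(i < m) n ^+ i) * (1 - n).
  elim: m {n0} => [|m IHm]; first by rewrite big_ord0 mul0r expr0 subrr.
  by rewrite big_ord_recr /= mulrDl -IHm mulrBr mulr1 -exprSr addrA subrK.
by rewrite n0 subr0 mul1r.
Qed.

End VertexArrowCombinations.

(** * Algebras with one arrow out of each vertex *)

Section Deterministic.
Variables (K : fieldType) (G : pzRingType) (kap : {rmorphism K -> G}).
Hypothesis kapC : forall c x, kap c * x = x * kap c.
Variables (V A : finType) (ev : V -> G) (al : A -> G) (so ta : A -> V).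
Hypothesis soI : injective so.
Hypothesis evK : forall v, ev v * ev v = ev v.
Hypothesis ev_orth : forall v w, v != w -> ev v * ev w = 0.
Hypothesis ev1 : \sum_v ev v = 1.
Hypothesis ev_neq0 : forall v, ev v <> 0.
Hypothesis al_so : forall a, al a * ev (so a) = al a.
Hypothesis al_ta : forall a, ev (ta a) * al a = al a.
Hypothesis al_gen_right : forall x, vertex_arrow_comb kap ev al x.
Hypothesis al_gen_left : forall x,
  vertex_arrow_comb (converse_rmorphism kap) (ev : V -> G^c) (al : A -> G^c) x.
Hypothesis al_nil : exists N, forall s : seq A, size s = N -> \prod_(a <- s) al a = 0.
Hypothesis al_sum_nil : exists N, (\sum_a al a) ^+ N = 0.
Hypothesis path_ind : forall P : G -> Prop, P 0 -> (forall x y, P x -> P y -> P (x + y)) ->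
  (forall c x, P x -> P (kap c * x)) -> (forall v, P (ev v)) ->
  (forall x a, P x -> P (x * al a)) -> forall x, P x.
Implicit Types (v w : V) (a : A).

(* A sink is its own successor. *)
Definition succ v : V := if [pick a | so a == v] is Some a then ta a else v.

(** As sources are distinct, [t * ev v] is the only arrow out of [v], or zero at a sink, and
    [t ^+ i * ev v] is the only path of length [i] from [v]. *)
Definition arrows_sum : G := \sum_a al a.
Local Notation t := arrows_sum.

Lemma succ_so a : succ (so a) = ta a.
Proof.
rewrite /succ; case: pickP => [b /eqP/soI -> //|/(_ a)].
by rewrite eqxx.
Qed.

Lemma arrows_so a : t * ev (so a) = al a.
Proof.
rewrite mulr_suml (bigD1 a) //= al_so big1 ?addr0 // => b ba.
rewrite -al_so -mulrA ev_orth ?mulr0 //.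
by apply: contra_neq ba => /soI.
Qed.

Lemma arrows_sink v : (forall a, so a <> v) -> t * ev v = 0.
Proof.
move=> nv; rewrite mulr_suml big1 // => a _.
by rewrite -al_so -mulrA ev_orth ?mulr0 //; apply/eqP; exact: nv.
Qed.

Lemma arrows_succ v : ev (succ v) * t * ev v = t * ev v.
Proof.
have [[a <-]|/forallNP nv] := pselect (exists a, so a = v).
  by rewrite -mulrA arrows_so succ_so al_ta.
by rewrite -mulrA arrows_sink ?mulr0.
Qed.

Lemma arrowsX i v : t ^+ i.+1 * ev v = t ^+ i * ev (succ v) * (t * ev v).
Proof. by rewrite exprSr -mulrA -[RHS]mulrA (mulrA (ev _)) arrows_succ. Qed.

Lemma arrows_iter i v : ev (iter i succ v) * (t ^+ i * ev v) = t ^+ i * ev v.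
Proof.
elim: i v => [|i IHi] v; first by rewrite expr0 mul1r evK.
by rewrite arrowsX (mulrA (ev _)) iterSr IHi.
Qed.

Lemma len_ex v : exists n, t ^+ n * ev v == 0.
Proof. by have [m m0] := al_sum_nil; exists m; rewrite m0 mul0r. Qed.

Definition len v : nat := ex_minn (len_ex v).

Lemma lenP v i : t ^+ i * ev v = 0 <-> (len v <= i)%N.
Proof.
rewrite /len; case: ex_minnP => n /eqP n0 nmin; split=> [/eqP/nmin //|ni].
by rewrite -(subnK ni) exprD -mulrA n0 mulr0.
Qed.

Lemma len_gt0 v : (0 < len v)%N.
Proof.
rewrite ltnNge; apply/negP => /lenP; rewrite expr0 mul1r; exact: ev_neq0.
Qed.

Definition cut_span (F : nat -> G) (N : nat) (x : G) : Prop :=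
  exists c : nat -> K, x = \sum_(i < N) kap (c i) * F i.

Section CutSpan.
Variables (F : nat -> G) (N : nat).
Hypothesis F0 : forall i, (N <= i)%N -> F i = 0.

Lemma cut_span0 : cut_span F N 0.
Proof. by exists (fun=> 0); rewrite big1 // => i _; rewrite rmorph0 mul0r. Qed.

Lemma cut_spanD x y : cut_span F N x -> cut_span F N y -> cut_span F N (x + y).
Proof.
move=> [c ->] [d ->]; exists (fun i => c i + d i); rewrite -big_split.
by apply: eq_bigr => i _ /=; rewrite rmorphD mulrDl.
Qed.

Lemma cut_spanZ c x : cut_span F N x -> cut_span F N (kap c * x).
Proof.
move=> [d ->]; exists (fun i => c * d i); rewrite mulr_sumr.
by apply: eq_bigr => i _; rewrite rmorphM mulrA.
Qed.

Lemma cut_span_gen i : cut_span F N (F i).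
Proof.
have [lt|ge] := ltnP i N; last by rewrite F0 //; exact: cut_span0.
exists (fun j => (j == i)%:R); rewrite (bigD1 (Ordinal lt)) //= eqxx rmorph1 mul1r.
rewrite big1 ?addr0 // => j; rewrite -val_eqE /= => /negbTE ->.
by rewrite rmorph0 mul0r.
Qed.

Lemma cut_span_sum M (P : pred 'I_M) (c : 'I_M -> K) (k : 'I_M -> nat) :
  cut_span F N (\sum_(i | P i) kap (c i) * F (k i)).
Proof.
apply: (big_ind (cut_span F N)) => [|x y|i _]; [exact: cut_span0|exact: cut_spanD|].
by apply: cut_spanZ; exact: cut_span_gen.
Qed.

End CutSpan.

(** Induction along paths extended on the right: an arrow out of [v] turns powers of [t] at [succ v]
    into powers at [v] with exponents raised by one. *)
Lemma span_arrows v x : x * ev v = x -> cut_span (fun i => t ^+ i * ev v) (len v) x.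
Proof.
have F0 w i : (len w <= i)%N -> t ^+ i * ev w = 0 by move/lenP.
move=> <-; elim/path_ind: x v => [v|x y Hx Hy v|c x Hx v|w v|x a Hx v].
- by rewrite mul0r; exact: cut_span0.
- by rewrite mulrDl; apply: cut_spanD.
- by rewrite -mulrA; apply: cut_spanZ.
- have [->|wv] := eqVneq w v; last by rewrite ev_orth //; exact: cut_span0.
  have := @cut_span_gen (fun i => t ^+ i * ev v) (len v) (F0 v) 0%N.
  by rewrite expr0 mul1r evK.
have [<-|nav] := eqVneq (so a) v; last first.
  rewrite -al_so -!mulrA ev_orth // !mulr0; exact: cut_span0.
rewrite -mulrA al_so -al_ta mulrA; have [c ->] := Hx (ta a).
rewrite mulr_suml (eq_bigr (fun i : 'I_(len (ta a)) =>
  kap (c i) * (t ^+ i.+1 * ev (so a)))) => [|i _].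
  exact: (@cut_span_sum (fun i => t ^+ i * ev (so a)) _ (F0 _) _ xpredT (fun i => c i)
    (fun i => i.+1)).
by rewrite arrowsX succ_so arrows_so !mulrA.
Qed.

Lemma fdim_arrows : exists (J : finType) (g : J -> G),
  forall x, exists c, x = \sum_j kap (c j) * g j.
Proof.
have [m m0] := al_sum_nil.
exists (V * 'I_m)%type, (fun vi : V * 'I_m => t ^+ vi.2 * ev vi.1) => x.
have H v : exists c : nat -> K, x * ev v = \sum_(i < m) kap (c i) * (t ^+ i * ev v).
  have [|c ->] := @span_arrows v (x * ev v); first by rewrite -mulrA evK.
  apply: (@cut_span_sum (fun i => t ^+ i * ev v) m _ _ xpredT (fun i => c i)
    (fun i => i)) => i mi.
  by rewrite -(subnK mi) exprD m0 mulr0 mul0r.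
have /choice[c Ec] := H; exists (fun vi : V * 'I_m => c vi.1 vi.2).
rewrite -[x]mulr1 -ev1 mulr_sumr -(pair_big xpredT xpredT
  (fun v (i : 'I_m) => kap (c v i) * (t ^+ i * ev v))) /=.
by apply: eq_bigr => v _; rewrite Ec.
Qed.

Lemma filter_span v w N (c : nat -> K) x :
  x = \sum_(i < N) kap (c i) * (t ^+ i * ev v) -> ev w * x = x ->
  x = \sum_(i < N) kap (if iter i succ v == w then c i else 0) * (t ^+ i * ev v).
Proof.
move=> Ex <-; rewrite Ex mulr_sumr; apply: eq_bigr => i _.
rewrite mulrA -kapC -mulrA; have [Ei|ni] := eqVneq (iter i succ v) w.
  by rewrite -Ei arrows_iter.
by rewrite -{1}arrows_iter (mulrA (ev w)) ev_orth 1?eq_sym // mul0r mulr0 rmorph0 mul0r.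
Qed.

(** If the leading term were nonzero, multiplication by a suitable power of [t] would move it to the
    last nonzero exponent [len v - 1] and kill all later terms. *)
Lemma leading_term v k N (c : nat -> K) i0 :
  \sum_(i < N) kap (c i) * (t ^+ (i + k) * ev v) = 0 -> (i0 < N)%N -> c i0 <> 0 ->
  (forall i, (i < i0)%N -> c i = 0) -> (len v <= i0 + k)%N.
Proof.
move=> E lt ci0 cmin; rewrite leqNgt; apply/negP => ltl; apply: ci0.
apply/eqP/negP => /negP ci0.
have : t ^+ (len v - (i0 + k).+1) * (\sum_(i < N) kap (c i) * (t ^+ (i + k) * ev v)) = 0.
  by rewrite E mulr0.
rewrite mulr_sumr (bigD1 (Ordinal lt)) //= big1 ?addr0 => [|i].
  rewrite mulrA -kapC -mulrA (mulrA (t ^+ _)) -exprD => H.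
  have : t ^+ (len v - (i0 + k).+1 + (i0 + k)) * ev v = 0.
    by rewrite -[LHS]mul1r -(rmorph1 kap) -(mulVf ci0) rmorphM -mulrA H mulr0.
  by move=> /lenP; move: ltl; clear; lia.
rewrite -val_eqE /= => ii0; have [lti|gei] := ltnP i i0.
  by rewrite cmin // rmorph0 mul0r mulr0.
rewrite mulrA -kapC -mulrA (mulrA (t ^+ _)) -exprD (lenP _ _).2 ?mulr0 //.
by move: ii0 gei ltl; clear; lia.
Qed.

Lemma span_neq0 N (F : nat -> G) (c : nat -> K) :
  \sum_(i < N) kap (c i) * F i <> 0 ->
  exists i0, [/\ (i0 < N)%N, c i0 <> 0 & forall i, (i < i0)%N -> c i = 0].
Proof.
move=> nz.
have ex : exists i, (i < N)%N && (c i != 0).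
  apply: contrapT => /forallNP H; apply: nz; apply: big1 => i _.
  have := H i; rewrite ltn_ord /= => /negP; rewrite negbK => /eqP ->.
  by rewrite rmorph0 mul0r.
case: (ex_minnP ex) => i0 /andP[lt /eqP ci0] i0min; exists i0; split=> // i ii0.
apply/eqP/negP => /negP ci; have := i0min i; rewrite ci (ltn_trans ii0 lt) => /(_ isT).
by rewrite leqNgt ii0.
Qed.

(** * Left modules *)

Definition left_below x v : Prop :=
  exists2 j, (len x <= j < (len (succ x)).+1)%N & iter j succ x = v.

(** Only the arrow [a] out of [x] contributes. The leading exponent [i0] of [h a] is less than
    [len (succ x)], and [h a * al a = 0] forces [len x <= i0 + 1]; the witness is [i0.+1]. *)
Lemma left_belowP x v (h : A -> G) :
  (forall a, ev v * h a = h a) ->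
  (forall a, h a * (if so a == x then ev (ta a) else 0) = h a) ->
  \sum_a h a * al a = 0 -> (exists a, h a <> 0) -> left_below x v.
Proof.
move=> vh hx E [a nz].
have Ea : so a = x.
  by apply: contrapT => /eqP/negbTE ne; apply: nz; rewrite -hx ne mulr0.
have ha : h a * ev (ta a) = h a by have := hx a; rewrite Ea eqxx.
have {}E : h a * al a = 0.
  rewrite -E (bigD1 a) //= big1 ?addr0 // => b ba.
  rewrite -hx; case: eqP => [Eb|_]; last by rewrite mulr0 mul0r.
  by case/eqP: ba; apply: soI; rewrite Eb.
have [c Ec] := span_arrows ha.
have Ec' := filter_span Ec (vh a).
set c' := fun i => if iter i succ (ta a) == v then c i else 0.
have [|i0 [lt ci0 cmin]] := @span_neq0 (len (ta a)) (fun i => t ^+ i * ev (ta a)) c'.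
  by rewrite -Ec'.
have lx : (len x <= i0 + 1)%N.
  apply: (@leading_term x 1 (len (ta a)) c') => //.
  rewrite -[RHS]E Ec' mulr_suml; apply: eq_bigr => i _.
  by rewrite addn1 -Ea arrowsX succ_so arrows_so !mulrA.
exists i0.+1; first by rewrite -addn1 lx -Ea succ_so addn1 ltnS.
move: ci0; rewrite /c'; case: eqP => // Ei _.
by rewrite iterSr -Ea succ_so.
Qed.

Theorem left_contravariantly_finite :
  contravariantly_finite (@fin_gen_finite_pdim G) (@fin_gen G).
Proof.
have Gfd : fdim kap G^o.
  have [J [g gS]] := fdim_arrows; exists J, g => x.
  by have [c Ec] := gS x; exists c; rewrite combT.
apply: (serial_contravariantly_finite kapC Gfd evK ev_orth ev1 al_so al_ta al_gen_right
  al_nil left_belowP (Vc := fun=> True) (tau := succ) (lam := len) (t := t)) => //.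
- by move=> v _; exact: arrows_succ.
- by move=> v _; exact: len_gt0.
- by move=> v i _; exact: lenP.
- by move=> r v x _ _ xv _; split=> //; have [c Ec] := span_arrows xv; exists c.
- move=> v j _ nRv lj jl; apply: (recurrent_below nRv).
  by exists j; rewrite ?lj.
- by move=> v /recurrent_step[w [j Hj <-] Rw]; exists j.
Qed.

(** * Right modules and the vertices on cycles *)

Definition periodic v : Prop := exists2 k, (0 < k)%N & iter k succ v = v.

Lemma iter_periodic m v : (#|V| <= m)%N -> periodic (iter m succ v).
Proof.
move=> le; have := looping_order succ v => /trajectP[i lti Ei].
have lem : (order succ v <= m)%N by apply: leq_trans le; exact: max_card.
have Ek : iter (order succ v - i) succ (iter i succ v) = iter i succ v.
  by rewrite -iterD subnK // ltnW.
exists (order succ v - i)%N; first by rewrite subn_gt0.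
rewrite -(subnK (leq_trans (ltnW lti) lem)) !(iterD (m - i)) -iterD.
by rewrite (addnC (order succ v - i)%N) iterD Ek.
Qed.

Lemma periodic_iter i v : periodic v -> periodic (iter i succ v).
Proof. by move=> [k k0 Ek]; exists k; rewrite // -iterD addnC iterD Ek. Qed.

Lemma iter_mul_periodic k n v : iter k succ v = v -> iter (n * k) succ v = v.
Proof. by move=> Ek; elim: n => [|n IHn] //; rewrite mulSn iterD IHn. Qed.

Lemma succ_inj v w : periodic v -> periodic w -> succ v = succ w -> v = w.
Proof.
move=> [k k0 Ek] [n n0 En] E.
have Ev := iter_mul_periodic n Ek; have Ew := iter_mul_periodic k En.
rewrite mulnC in Ew; move: Ev Ew; rewrite -(prednK (_ : 0 < n * k)%N) ?muln_gt0 ?k0 ?n0 //.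
by rewrite !iterSr E => E1 E2; rewrite -E1 E2.
Qed.

Lemma prev_ex v : exists w, periodic v -> periodic w /\ succ w = v.
Proof.
have [[k k0 Ek]|nv] := pselect (periodic v); last by exists v.
exists (iter k.-1 succ v) => pv; split; first exact: periodic_iter.
by rewrite -iterS prednK.
Qed.

Definition prev v : V := sval (cid (prev_ex v)).

Lemma prevP v : periodic v -> periodic (prev v) /\ succ (prev v) = v.
Proof. exact: svalP (cid (prev_ex v)). Qed.

Lemma iter_prev i v : periodic v -> periodic (iter i prev v).
Proof. by move=> pv; elim: i => //= i /prevP[]. Qed.

Lemma succ_iter_prev i v : periodic v -> iter i succ (iter i prev v) = v.
Proof.
by move=> pv; elim: i => // i IHi; rewrite iterSr iterS (prevP (iter_prev i pv)).2.
Qed.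

Lemma prev_iter_succ i v w : periodic w -> iter i succ w = v -> iter i prev v = w.
Proof.
move=> pw; elim: i v => //= i IHi v <-; rewrite -iterS iterSr.
apply: IHi; have ps := periodic_iter i.+1 pw.
by have [pp Ep] := prevP ps; apply/esym/succ_inj => //; exact: periodic_iter.
Qed.

(** Several arrows may end at a periodic [v], but only one comes from a periodic vertex; keeping
    just these, [ev v * u ^+ i] is the single path of length [i] into [v] along its cycle. *)
Definition periodic_arrows : G := t * \sum_(v | `[< periodic v >]) ev v.
Local Notation u := periodic_arrows.

Lemma periodic_arrowsX i v : periodic v -> ev v * u ^+ i = t ^+ i * ev (iter i prev v).
Proof.
move=> pv; elim: i => [|i IHi]; first by rewrite !expr0 mulr1 mul1r.
have pw := iter_prev i pv; have [pp Ep] := prevP pw.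
rewrite exprSr mulrA IHi -mulrA exprSr -mulrA; congr (_ * _).
rewrite /u mulrA mulr_sumr (bigD1 (prev (iter i prev v))) /=; last exact/asboolP.
rewrite big1 ?addr0 => [|w /andP[/asboolP pw' ne]].
  by rewrite -mulrA -arrows_succ Ep !mulrA evK.
rewrite -mulrA -arrows_succ !mulrA ev_orth ?mul0r //.
by apply: contra_neq ne => E; apply: succ_inj; rewrite ?Ep.
Qed.

Lemma colen_ex v : exists n, periodic v -> forall i, ev v * u ^+ i = 0 <-> (n <= i)%N.
Proof.
have [pv|npv] := pselect (periodic v); last by exists 0%N.
have ex : exists n, ev v * u ^+ n == 0.
  by have [m m0] := al_sum_nil; exists m; rewrite periodic_arrowsX // m0 mul0r.
case: (ex_minnP ex) => n /eqP n0 nmin; exists n => _ i; split=> [/eqP/nmin //|ni].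
by rewrite -(subnKC ni) exprD mulrA n0 mul0r.
Qed.

Definition colen v : nat := sval (cid (colen_ex v)).

Lemma colenP v i : periodic v -> ev v * u ^+ i = 0 <-> (colen v <= i)%N.
Proof. by move=> pv; exact: svalP (cid (colen_ex v)) pv i. Qed.

Lemma colen_len v i w : periodic w -> iter i succ w = v ->
  (colen v <= i)%N = (len w <= i)%N.
Proof.
move=> pw Ei; have pv : periodic v by rewrite -Ei; exact: periodic_iter.
apply/idP/idP.
  by move=> /(colenP _ pv); rewrite periodic_arrowsX // (prev_iter_succ pw Ei) => /lenP.
by move=> /lenP E; apply/colenP; rewrite // periodic_arrowsX // (prev_iter_succ pw Ei).
Qed.

Definition right_below x v : Prop := iter (len v) succ v = x.

(** A recurrent vertex lies [len w > 0] steps after a recurrent [w]. Going back often enough puts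
    [v] at least [#|V|] steps after some vertex, hence on a cycle. *)
Lemma right_recurrent_periodic v : recurrent right_below v -> periodic v.
Proof.
move=> Rv; have [n [w [le _ <-]]] : exists n w,
    [/\ (#|V| <= n)%N, recurrent right_below w & iter n succ w = v].
  elim: #|V| => [|k [n [w [le Rw Ew]]]]; first by exists 0%N, v.
  have [w' Ew' Rw'] := recurrent_step Rw.
  exists (n + len w')%N, w'; split=> //; last by rewrite iterD Ew'.
  by have := len_gt0 w'; move: le; clear; lia.
exact: iter_periodic.
Qed.

(** Different arrows have different sources, so an exponent [i] occurs in [h a] for at most one [a].
    The relation is thus a single combination of powers of [t] without cancellation between arrows;
    its leading exponent [i0] satisfies [i0 < len v <= i0 + 1]. *)
Lemma right_belowP x v (h : A -> G) :
  (forall a, h a * ev v = h a) ->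
  (forall a, (if ta a == x then ev (so a) else 0) * h a = h a) ->
  \sum_a al a * h a = 0 -> (exists a, h a <> 0) -> right_below x v.
Proof.
move=> hv xh E [a0 nz].
have /choice[c Ec] : forall a, exists c : nat -> K,
    h a = \sum_(i < len v) kap (c i) * (t ^+ i * ev v).
  by move=> a; exact: span_arrows (hv a).
pose c' a i := if (ta a == x) && (iter i succ v == so a) then c a i else 0.
have Ec' a : h a = \sum_(i < len v) kap (c' a i) * (t ^+ i * ev v).
  rewrite /c'; have [tx|ntx] := eqVneq (ta a) x; last first.
    rewrite -xh (negbTE ntx) mul0r big1 // => i _; by rewrite rmorph0 mul0r.
  by apply: filter_span (Ec a) _; rewrite -{2}xh tx eqxx.
pose d i := \sum_a c' a i.
have dE i a : c' a i <> 0 -> d i = c' a i.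
  move=> nz'; rewrite /d (bigD1 a) //= big1 ?addr0 // => b ba.
  move: nz'; rewrite /c'; case: ifP => // /andP[_ /eqP Ea] _.
  case: ifP => // /andP[_ /eqP Eb]; case/eqP: ba; apply: soI.
  by rewrite -Ea -Eb.
have [|j [ltj cj _]] := @span_neq0 (len v) (fun i => t ^+ i * ev v) (c' a0).
  by rewrite -Ec'.
have sumE : \sum_(i < len v) kap (d i) * (t ^+ (i + 1) * ev v) = 0.
  rewrite -[RHS]E (eq_bigr (fun a => \sum_(i < len v)
    kap (c' a i) * (t ^+ (i + 1) * ev v))) => [|a _].
    rewrite exchange_big; apply: eq_bigr => i _.
    by rewrite rmorph_sum mulr_suml.
  rewrite {1}Ec' mulr_sumr; apply: eq_bigr => i _; rewrite mulrA -kapC -mulrA.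
  have [->|] := pselect (c' a i = 0); first by rewrite rmorph0 !mul0r.
  rewrite /c'; case: ifP => // /andP[_ /eqP Ea] _; congr (_ * _).
  by rewrite -arrows_iter Ea mulrA -arrows_so -(mulrA t) evK -Ea -mulrA arrows_iter mulrA
    -exprS addn1.
have exd : exists i, (i < len v)%N && (d i != 0).
  by exists j; rewrite ltj (dE j a0 cj); exact/eqP.
case: (ex_minnP exd) => i0 /andP[lt /eqP di0] imin.
have le : (len v <= i0 + 1)%N.
  apply: (leading_term sumE lt di0) => i ii0; apply/eqP/negP => /negP di.
  by have := imin i; rewrite di (ltn_trans ii0 lt) leqNgt ii0 => /(_ isT).
have Elen : len v = i0.+1 by apply/eqP; rewrite eqn_leq -{1}addn1 le lt.
have [a ca] : exists a, c' a i0 <> 0.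
  by apply: contrapT => /forallNP H; apply: di0; apply: big1 => a _; apply: contrapT; exact: H.
move: ca; rewrite /c'; case: ifP => // /andP[/eqP <- /eqP Ea] _.
by rewrite /right_below Elen iterS Ea succ_so.
Qed.

Lemma converse_exp (x : G) n : (x : G^c) ^+ n = x ^+ n :> G.
Proof. by elim: n => // n IHn; rewrite exprS exprSr -IHn. Qed.

Lemma converse_prod (s : seq A) :
  \prod_(a <- s) (al a : G^c) = \prod_(a <- rev s) al a :> G.
Proof.
elim: s => [|a s IHs]; first by rewrite !big_nil.
by rewrite big_cons rev_cons -cats1 big_cat big_seq1 -IHs.
Qed.

Theorem right_contravariantly_finite :
  contravariantly_finite (@fin_gen_finite_pdim G^c) (@fin_gen G^c).
Proof.
pose kapc := converse_rmorphism kap; pose evc : V -> G^c := ev; pose alc : A -> G^c := al.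
have kapcC (c : K) (x : G^c) : kapc c * x = x * kapc c by exact: esym (kapC c x).
have Gfd : fdim kapc (G^c)^o.
  have [J [g gS]] := fdim_arrows; exists J, g => x.
  have [c Ec] := gS x; exists c; rewrite combT [LHS]Ec; apply: eq_bigr => j _.
  exact: kapC.
have evcK v : evc v * evc v = evc v by exact: evK.
have evc_orth v w : v != w -> evc v * evc w = 0.
  by move=> vw; apply: ev_orth; rewrite eq_sym.
have alc_nil : exists N, forall s : seq A, size s = N -> \prod_(a <- s) alc a = 0.
  have [N N0] := al_nil; exists N => s sN.
  by apply: etrans (converse_prod s) _; apply: N0; rewrite size_rev.
apply: (serial_contravariantly_finite kapcC Gfd evcK evc_orth ev1 (so := ta) (ta := so)
  al_ta al_so al_gen_left alc_nil (below := right_below) right_belowP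
  right_recurrent_periodic (tau := prev) (lam := colen) (t := (u : G^c))).
- by move=> v /prevP[].
- move=> v pv; change (ev v * (u * ev (prev v)) = ev v * u).
  have := periodic_arrowsX 1 pv; rewrite !expr1 /= => E.
  by rewrite mulrA E -mulrA evK.
- move=> v pv; rewrite ltnNge; apply/negP => /(colenP _ pv).
  by rewrite expr0 mulr1; exact: ev_neq0.
- by move=> v i pv; rewrite converse_exp; exact: colenP.
- move=> r v x Rr rx xv nz; have xr : (x : G) * ev r = x := rx.
  have vx : ev v * (x : G) = x := xv.
  have pr := right_recurrent_periodic Rr.
  have [c Ec] := span_arrows xr; have Ec' := filter_span Ec vx.
  set c' := fun i => if iter i succ r == v then c i else 0.
  have [|i0 [lt ci0 _]] := @span_neq0 (len r) (fun i => t ^+ i * ev r) c'.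
    by rewrite -Ec'.
  have Ei0 : iter i0 succ r = v by move: ci0; rewrite /c'; case: eqP.
  have pv : periodic v by rewrite -Ei0; exact: periodic_iter.
  split=> //; have F0 i : (colen v <= i)%N -> ev v * u ^+ i = 0 by move/(colenP _ pv).
  have [d Ed] : cut_span (fun i => ev v * u ^+ i) (colen v) x.
    (* As [r] is periodic, a path from [r] to [v] is also the path of that length into [v] along the
       cycle. *)
    rewrite Ec' (eq_bigr (fun i : 'I_(len r) => kap (c' i) * (ev v * u ^+ i))) => [|i _].
      exact: (@cut_span_sum (fun i => ev v * u ^+ i) _ F0 _ xpredT (fun i => c' i)
        (fun i => i)).
    rewrite /c'; case: eqP => [Ei|_]; last by rewrite rmorph0 !mul0r.
    by rewrite periodic_arrowsX // (prev_iter_succ pr Ei).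
  exists d; rewrite [LHS]Ed; apply: eq_bigr => i _.
  by rewrite kapC -(converse_exp u).
- move=> v j pv nRv le lt; apply: (recurrent_below nRv).
  have j0 : (0 < j)%N.
    apply: leq_trans le; rewrite ltnNge; apply/negP => /(colenP _ pv).
    by rewrite expr0 mulr1; exact: ev_neq0.
  have [pp Ep] := prevP pv.
  have pw := iter_prev j pv; have Ej := succ_iter_prev j pv.
  rewrite /right_below; set w := iter j prev v in pw Ej *.
  (* The bounds on [j] say that the path of length [j] out of [w] vanishes and that of length [j.-1]
     does not. *)
  have le1 : (len w <= j)%N by rewrite -(colen_len pw Ej).
  have Ej' : iter j.-1 succ w = prev v.
    by rewrite /w -(prednK j0) iterSr /=; exact: succ_iter_prev.
  have lt1 : (j.-1 < len w)%N.
    by rewrite ltnNge -(colen_len pw Ej') -ltnNge -ltnS prednK.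
  have -> : len w = j by move: le1 lt1 j0; clear; lia.
  exact: Ej.
- move=> v Rv; have [w Ew Rw] := recurrent_step Rv.
  have pw := right_recurrent_periodic Rw; have pv := right_recurrent_periodic Rv.
  have l0 := len_gt0 w.
  have Ew' : iter (len w).-1 succ w = prev v.
    apply: succ_inj; first exact: periodic_iter.
      exact: (prevP pv).1.
    by rewrite (prevP pv).2 -iterS prednK.
  exists (len w); last by rewrite (prev_iter_succ pw Ew).
  rewrite (colen_len pw Ew) leqnn ltnS.
  have : ((len w).-1 < colen (prev v))%N by rewrite ltnNge (colen_len pw Ew') -ltnNge prednK.
  by rewrite prednK.
Qed.

End Deterministic.

(** * Bound quiver algebras *)

Section BoundQuiverAlgebra.
Variables (K : fieldType) (Q : quiver) (I : ideal (path_algebra K Q)).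
Hypothesis admI : admissible I.
Local Notation L := (quotient_ring I).
Local Notation PA := (path_algebra K Q).
Local Notation pi := (@quotient_pi _ I).
Local Notation V := (vertex Q).
Local Notation A := (arrow Q).
Implicit Types (f g : PA) (p q : qpath Q) (v w : V) (a : A).

Lemma pi_onto (x : L) : exists f, x = pi f.
Proof. by exists (quotient_repr x); rewrite quotient_reprK. Qed.

Lemma pi0P f : pi f = 0 <-> I f.
Proof. by rewrite -(rmorph0 pi) quotient_piP subr0. Qed.

Definition scalar (c : K) : L := pi (c *: (1 : PA)).

Lemma scalar_pi c f : scalar c * pi f = pi (c *: f).
Proof. by rewrite -rmorphM -path_algebra_scalerAl mul1r. Qed.

Lemma scalar_zmod_morphism : zmod_morphism scalar.
Proof. by move=> c d; rewrite /scalar scalerBl rmorphB. Qed.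

Lemma scalar_monoid_morphism : monoid_morphism scalar.
Proof.
by split=> [|c d]; rewrite /scalar ?scale1r ?rmorph1 // [RHS]scalar_pi scalerA.
Qed.

HB.instance Definition _ := GRing.isZmodMorphism.Build K L scalar scalar_zmod_morphism.
HB.instance Definition _ := GRing.isMonoidMorphism.Build K L scalar scalar_monoid_morphism.

Lemma scalarC c (x : L) : scalar c * x = x * scalar c.
Proof.
have [f ->] := pi_onto x; rewrite scalar_pi -rmorphM -path_algebra_scalerAr.
by rewrite mulr1.
Qed.

Definition pathL p : L := pi (path_elt K p).
Definition vertexL v : L := pathL (vertex_path v).
Definition arrowL a : L := pathL (arrow_path a).

Lemma quotient_ind (P : L -> Prop) : P 0 -> (forall x y, P x -> P y -> P (x + y)) ->
  (forall c x, P x -> P (scalar c * x)) -> (forall p, P (pathL p)) -> forall x, P x.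
Proof.
move=> P0 PD PZ Pp x; have [f ->] := pi_onto x.
elim/pa_ind: f => [|f g Pf Pg|c f Pf|p]; rewrite ?rmorph0 ?rmorphD //.
- exact: PD.
- by rewrite -scalar_pi; exact: PZ.
- exact: Pp.
Qed.

Lemma path_elt_cat v w s s' (h : walk v (s ++ s')) (h1 : walk v s) (h2 : walk w s') :
  endpoint v s = w ->
  path_elt K (@QPath Q (v, s ++ s') h) =
    path_elt K (@QPath Q (w, s') h2) * path_elt K (@QPath Q (v, s) h1).
Proof.
move=> E; rewrite path_eltM.
have [r [-> sr _ ar]] := @path_mulP Q (@QPath Q (w, s') h2) (@QPath Q (v, s) h1) E.
by congr (path_elt K _); apply: path_eq; rewrite ?sr ?ar.
Qed.

Lemma arrow_pathE a v (h : walk v [:: a]) : @QPath Q (v, [:: a]) h = arrow_path a.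
Proof. by apply: path_eq => //; have /andP[/eqP E _] := h; exact: esym E. Qed.

Lemma vertex_pathE v (h : walk v [::]) : @QPath Q (v, [::]) h = vertex_path v.
Proof. exact: path_eq. Qed.

Lemma pathL_cons v a s (h : walk v (a :: s)) :
  exists h' : walk (tgt a) s,
    pathL (@QPath Q (v, a :: s) h) = pathL (@QPath Q (tgt a, s) h') * arrowL a.
Proof.
have /andP[va h'] := h; exists h'.
have h1 : walk v [:: a] by rewrite /= va.
rewrite /pathL (@path_elt_cat v (tgt a) [:: a] s h h1 h') // rmorphM.
by rewrite arrow_pathE.
Qed.

Lemma path_elt_rcons v a s (h : walk v (rcons s a)) :
  exists h' : walk v s, path_elt K (@QPath Q (v, rcons s a) h) =
    path_elt K (arrow_path a) * path_elt K (@QPath Q (v, s) h').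
Proof.
move: h; rewrite -cats1 => h; have := h; rewrite walk_cat => /andP[h' h2].
by exists h'; rewrite (path_elt_cat h h' h2) // arrow_pathE.
Qed.

Lemma vertexL_mul v w : vertexL v * vertexL w = if v == w then vertexL v else 0.
Proof.
rewrite -rmorphM path_eltM vertex_path_mull /path_tgt /= eq_sym.
by case: eqP => [->|] //=; rewrite rmorph0.
Qed.

Lemma vertexLK v : vertexL v * vertexL v = vertexL v.
Proof. by rewrite vertexL_mul eqxx. Qed.

Lemma vertexL_orth v w : v != w -> vertexL v * vertexL w = 0.
Proof. by rewrite vertexL_mul => /negbTE ->. Qed.

Lemma vertexL_sum : \sum_v vertexL v = 1.
Proof.
rewrite -(rmorph_sum pi); congr (pi _); rewrite -[RHS]/(pa_one K Q).
by rewrite pa_one.unlock.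
Qed.

Lemma arrowL_src a : arrowL a * vertexL (src a) = arrowL a.
Proof. by rewrite -rmorphM path_eltM vertex_path_mulr /path_src /= eqxx. Qed.

Lemma arrowL_tgt a : vertexL (tgt a) * arrowL a = arrowL a.
Proof. by rewrite -rmorphM path_eltM vertex_path_mull /path_tgt /= eqxx. Qed.

(** * Long paths and powers of the radical *)

Definition long_paths (n : nat) f : Prop :=
  forall p, (size (path_arrows p) < n)%N -> mcoeff p f = 0.

Lemma long_pathsD n f g : long_paths n f -> long_paths n g -> long_paths n (f + g).
Proof. by move=> Lf Lg p lt; rewrite mcoeffD Lf ?Lg ?addr0. Qed.

Lemma long_pathsZ n c f : long_paths n f -> long_paths n (c *: f).
Proof. by move=> Lf p lt; rewrite mcoeffZ Lf // mulr0. Qed.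

Lemma mcoeff_path p q : mcoeff q (path_elt K p) = (p == q)%:R.
Proof. by rewrite path_elt.unlock mcoeffU. Qed.

Lemma long_paths_path n p : (n <= size (path_arrows p))%N -> long_paths n (path_elt K p).
Proof.
move=> np q lt; rewrite mcoeff_path; case: eqP => // E; move: lt.
by rewrite -E ltnNge np.
Qed.

Lemma long_pathsP n f : long_paths n f ->
  forall p, p \in msupp f -> (n <= size (path_arrows p))%N.
Proof.
by move=> Lf p; rewrite -mcoeff_neq0 leqNgt => nz; apply/negP => /Lf E; rewrite E eqxx in nz.
Qed.

Lemma long_paths_mul m n f g : long_paths m f -> long_paths n g -> long_paths (m + n) (f * g).
Proof.
move=> /long_pathsP Lf /long_pathsP Lg; have -> : f * g = pa_mul f g by [].
rewrite pa_mul.unlock.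
rewrite big_seq; apply: big_ind => [p _|x y|p fp]; [by rewrite mcoeff0|exact: long_pathsD|].
rewrite big_seq; apply: big_ind => [q _|x y|q gq]; [by rewrite mcoeff0|exact: long_pathsD|].
apply: long_pathsZ; have [E|N] := eqVneq (path_tgt q) (path_src p).
  have [r [-> _ _ ar]] := path_mulP E; apply: long_paths_path.
  by rewrite ar size_cat addnC leq_add ?Lf ?Lg.
by rewrite (path_mulN N) => r _; rewrite mcoeff0.
Qed.

Definition long_ideal (n : nat) : ideal PA.
Proof.
exists (long_paths n).
- by move=> p _; rewrite mcoeff0.
- by move=> f g; exact: long_pathsD.
- by move=> f g Lg; rewrite -[n]add0n; exact: long_paths_mul.
- by move=> f g Lg; rewrite -[n]addn0; exact: long_paths_mul.
Defined.

Lemma arrow_ideal2_long f : ideal_exp (arrow_ideal K Q) 2 f -> long_paths 2 f.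
Proof.
have J1 g : arrow_ideal K Q g -> long_paths 1 g.
  by move=> /(_ (long_ideal 1)); apply=> _ [a ->]; exact: long_paths_path.
move=> /(_ (long_ideal 2)); apply=> _ [g [h [Jg Jh ->]]].
apply: (@long_paths_mul 1 1); first exact: J1.
move: Jh => /(_ (long_ideal 1)); apply=> _ [h1 [h2 [Jh1 _ ->]]].
by apply: (@long_paths_mul 1 0); first exact: J1.
Qed.

Lemma I_long f : I f -> long_paths 2 f.
Proof. by case: admI => H _ /H; exact: arrow_ideal2_long. Qed.

Definition radL (n : nat) (x : L) : Prop := exists2 f, long_paths n f & x = pi f.

Lemma radL_mul m n x y : radL m x -> radL n y -> radL (m + n) (x * y).
Proof.
move=> [f Lf ->] [g Lg ->]; exists (f * g); first exact: long_paths_mul.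
by rewrite rmorphM.
Qed.

Lemma radL_mull n x y : radL n y -> radL n (x * y).
Proof.
move=> Ry; rewrite -[n]add0n; apply: radL_mul => //.
by have [f ->] := pi_onto x; exists f.
Qed.

Lemma radL_mulr n x y : radL n x -> radL n (x * y).
Proof.
move=> Rx; rewrite -[n]addn0; apply: radL_mul => //.
by have [f ->] := pi_onto y; exists f.
Qed.

Lemma radLD n x y : radL n x -> radL n y -> radL n (x + y).
Proof.
move=> [f Lf ->] [g Lg ->]; exists (f + g); first exact: long_pathsD.
by rewrite rmorphD.
Qed.

Lemma radL0 n : radL n 0.
Proof. by exists 0; rewrite ?rmorph0 // => p _; rewrite mcoeff0. Qed.

Lemma radL_arrow a : radL 1 (arrowL a).
Proof. by exists (path_elt K (arrow_path a)) => //; exact: long_paths_path. Qed.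

Lemma radL_exp n x : radL 1 x -> radL n (x ^+ n).
Proof.
move=> Rx; elim: n => [|n IHn]; first by exists 1; rewrite ?rmorph1.
by rewrite exprS -add1n; exact: radL_mul.
Qed.

Lemma radL_nil : exists m, forall x, radL m x -> x = 0.
Proof.
case: admI => _ [m _ mI]; exists m => _ [f Lf ->]; apply/pi0P; apply: mI.
have Jpath n v s (h : walk v s) : (n <= size s)%N ->
    ideal_exp (arrow_ideal K Q) n (path_elt K (@QPath Q (v, s) h)).
  elim: n v s h => [|n IHn] v s h //; case/lastP: s h => [|s a] h //.
  rewrite size_rcons ltnS => ns; have [h' ->] := path_elt_rcons h.
  move=> J HJ; apply: HJ; exists (path_elt K (arrow_path a)), (path_elt K (@QPath Q (v, s) h')).
  by split=> //; [move=> J' HJ'; apply: HJ'; exists a|exact: IHn].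
rewrite [f]path_eltE big_seq; apply: big_ind => [|x y|p fp]; [exact: ideal_0|exact: ideal_D|].
have -> : f@_p *: path_elt K p = ((f@_p *: (1 : PA)) : PA) * path_elt K p.
  by rewrite -path_algebra_scalerAl mul1r.
apply: ideal_Ml; case: p fp => -[v s] h fp; apply: Jpath.
exact: (long_pathsP Lf fp).
Qed.

Lemma arrow_walkP (P : L -> Prop) : (forall v, P (vertexL v)) ->
  (forall x a, P x -> P (x * arrowL a)) -> forall p, P (pathL p).
Proof.
move=> Pv Pa [[v s] h]; elim: s v h => [|a s IHs] v h.
  by rewrite vertex_pathE; exact: Pv.
by have [h' ->] := pathL_cons h; apply: Pa; exact: IHs.
Qed.

Lemma arrow_walkPl (P : L -> Prop) : (forall v, P (vertexL v)) ->
  (forall x a, P x -> P (arrowL a * x)) -> forall p, P (pathL p).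
Proof.
move=> Pv Pa [[v s] h]; elim/last_ind: s h => [|s a IHs] h.
  by rewrite vertex_pathE; exact: Pv.
have [h' E] := path_elt_rcons h; rewrite /pathL E rmorphM.
by apply: Pa; exact: IHs.
Qed.

Lemma arrowL_gen_right (x : L) : vertex_arrow_comb scalar vertexL arrowL x.
Proof.
elim/quotient_ind: x => [|x y|c x|].
- exact: vertex_arrow_comb0.
- exact: vertex_arrow_combD.
- exact: vertex_arrow_combZ.
apply: arrow_walkP => [v|x a _]; first exact: vertex_arrow_comb_vertex.
exact: vertex_arrow_comb_arrow.
Qed.

Lemma arrowL_gen_left (x : L) :
  vertex_arrow_comb (converse_rmorphism scalar) (vertexL : V -> L^c) (arrowL : A -> L^c) x.
Proof.
elim/quotient_ind: x => [|x y|c x|].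
- exact: vertex_arrow_comb0.
- exact: vertex_arrow_combD.
- by rewrite scalarC; exact: vertex_arrow_combZ.
apply: arrow_walkPl => [v|x a _]; first exact: vertex_arrow_comb_vertex.
exact: vertex_arrow_comb_arrow.
Qed.

Lemma vertexL_neq0 v : vertexL v <> 0.
Proof.
move=> /pi0P/I_long/(_ (vertex_path v) isT); rewrite mcoeff_path eqxx => /eqP.
by rewrite oner_eq0.
Qed.

(** Coefficients at paths of length less than 2 are well defined modulo [I], which lies in the
    square of the arrow ideal. *)
Lemma radL1_vertex c v x : radL 1 x -> scalar c * vertexL v + x = 0 -> c = 0.
Proof.
move=> [f Lf ->]; rewrite scalar_pi -rmorphD => /pi0P/I_long/(_ (vertex_path v) isT).
by rewrite mcoeffD mcoeffZ mcoeff_path eqxx mulr1 (Lf (vertex_path v)) ?addr0.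
Qed.

Lemma vertexL_decomposition v x : x * vertexL v = x -> exists c y,
  [/\ x = scalar c * vertexL v + y, radL 1 y & y * vertexL v = y].
Proof.
move=> xv; have [c [h Ex]] := arrowL_gen_right x.
exists (c v), ((\sum_a h a * arrowL a) * vertexL v); split.
- rewrite -{1}xv Ex mulrDl; congr (_ + _).
  rewrite mulr_suml (bigD1 v) //= -[X in X + _ = _]mulrA vertexLK big1 ?addr0 // => w wv.
  by rewrite -mulrA vertexL_orth // mulr0.
- apply: radL_mulr; apply: (big_ind (radL 1)) => [|y z|a _]; [exact: radL0|exact: radLD|].
  exact/radL_mull/radL_arrow.
- by rewrite -mulrA vertexLK.
Qed.

Lemma local_left_inverse c v x : c != 0 -> radL 1 x -> x * vertexL v = x ->
  exists y, y * (scalar c * vertexL v + x) = vertexL v.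
Proof.
move=> c0 Rx xv; have [m m0] := radL_nil.
apply: (idem_left_inverse (m := m) c0 xv).
by apply: m0; apply: radL_exp; apply: radL_mull.
Qed.

Lemma arrowL_prod_nil : exists N, forall s : seq A, size s = N ->
  \prod_(a <- s) arrowL a = 0.
Proof.
have [m m0] := radL_nil; exists m => s sm; apply: m0; rewrite -sm.
elim: s {sm} => [|a s IHs]; first by exists 1; rewrite ?big_nil ?rmorph1.
by rewrite big_cons /= -add1n; apply: radL_mul => //; exact: radL_arrow.
Qed.

Lemma arrowL_sum_nil : exists N, (\sum_a arrowL a) ^+ N = 0.
Proof.
have [m m0] := radL_nil; exists m; apply: m0; apply: radL_exp.
apply: (big_ind (radL 1)) => [|x y|a _]; [exact: radL0|exact: radLD|exact: radL_arrow].
Qed.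

Lemma path_induction (P : L -> Prop) :
  P 0 -> (forall x y, P x -> P y -> P (x + y)) ->
  (forall c x, P x -> P (scalar c * x)) -> (forall v, P (vertexL v)) ->
  (forall x a, P x -> P (x * arrowL a)) -> forall x, P x.
Proof. by move=> P0 PD PZ Pv Pa; apply: quotient_ind => //; exact: arrow_walkP. Qed.

(** * The indecomposable projectives at the vertices *)

Let eps (v : V) (_ : unit) : L := vertexL v.
Let epsK v i : eps v i * eps v i = eps v i. Proof. exact: vertexLK. Qed.

Lemma vertex_projective v : projective (idem_sum (eps v)).
Proof. exact: (idem_sum_projective (epsK v)). Qed.

(** The endomorphism ring is local: when the generator is split as [u + w], the scalar parts of [u]
    and [w] add up to 1, so one of them is nonzero; that component is left invertible and generates
    the module. *)
Lemma vertex_indecomposable v : indecomposable (idem_sum (eps v)).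
Proof.
pose g := idem_gen (epsK v) tt.
have gE : idem_coord g tt = vertexL v by rewrite /g /idem_gen idem_ofE eqxx mul1r.
split; first by exists g => g0; apply: (@vertexL_neq0 v); rewrite -gE g0 idem_coord0.
move=> U W sU sW UW disj.
have full (S : idem_sum (eps v) -> Prop) u c y : is_submodule S -> S u -> c != 0 ->
    idem_coord u tt = scalar c * vertexL v + y -> radL 1 y -> y * vertexL v = y ->
    forall x, S x.
  move=> sS Su c0 Eu Ry yv x; have [z Ez] := local_left_inverse c0 Ry yv.
  have -> : x = (idem_coord x tt * z) *: u.
    by apply: idem_coordP => -[]; rewrite idem_coordZ Eu -mulrA Ez idem_coordK.
  exact: submoduleZ.
have [u [w [Uu Ww Eg]]] := UW g.
have [c [y [Ec Ry yv]]] := vertexL_decomposition (idem_coordK u tt).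
have [d [z [Ed Rz zv]]] := vertexL_decomposition (idem_coordK w tt).
have cd : c + d - 1 = 0.
  apply: (@radL1_vertex _ v (y + z)); first exact: radLD.
  have := gE; rewrite Eg idem_coordD Ec Ed => E.
  by rewrite rmorphB rmorphD rmorph1 mulrBl mulrDl mul1r addrAC addrACA E subrr.
have [c0|c0] := eqVneq c 0.
  have d0 : d != 0.
    by apply/eqP => d0; move/eqP: cd; rewrite c0 d0 addr0 sub0r oppr_eq0 oner_eq0.
  left=> x Ux; apply: disj => //; exact: (full W w d z).
right=> x Wx; apply: disj => //; exact: (full U u c y).
Qed.

(** For distinct arrows [a], [a'] out of [v], uniseriality would make one of them a left multiple of
    the other modulo [I], say [a = x a']. Comparing coefficients at the path [a] refutes this:
    elements of [I] have none there, nor has any multiple of [a']. *)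
Lemma src_inj : left_serial L -> injective (@src Q).
Proof.
move=> ls a a' Eaa'; apply: contrapT => naa'.
pose v := src a.
have key b b' : src b = v -> src b' = v -> b <> b' -> forall x, arrowL b <> x * arrowL b'.
  move=> bv bv' nbb' x; have [f ->] := pi_onto x; rewrite -rmorphM => /eqP.
  rewrite -subr_eq0 -rmorphB => /eqP/pi0P/I_long/(_ (arrow_path b) isT).
  rewrite mcoeffB mcoeff_path eqxx => /eqP; rewrite subr_eq0.
  suff -> : mcoeff (arrow_path b) (f * path_elt K (arrow_path b')) = 0 by rewrite oner_eq0.
  elim/pa_ind: f => [|f g Ef Eg|c f Ef|p].
  - by rewrite mul0r mcoeff0.
  - by rewrite mulrDl mcoeffD Ef Eg addr0.
  - by rewrite -path_algebra_scalerAl mcoeffZ Ef mulr0.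
  rewrite path_eltM; have [E|N] := eqVneq (path_tgt (arrow_path b')) (path_src p).
    have [r [-> _ _ ar]] := path_mulP E; rewrite mcoeff_path; case: eqP => // Er.
    by move: ar; rewrite Er /path_arrows /= => -[/nbb'].
  by rewrite path_mulN // mcoeff0.
pose U b (x : idem_sum (eps v)) := exists z, idem_coord x tt = z * arrowL b.
have sU b : is_submodule (U b).
  split=> [|z x y [u Eu] [w Ew]]; first by exists 0; rewrite idem_coord0 mul0r.
  by exists (z * u + w); rewrite idem_coordD idem_coordZ Eu Ew mulrDl mulrA.
have memU b : src b = v -> U b (idem_of (epsK v) (fun=> arrowL b)).
  by move=> bv; exists 1; rewrite idem_ofE /eps -bv arrowL_src mul1r.
have sub b b' : src b = v -> src b' = v -> b <> b' -> ~ forall x, U b x -> U b' x.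
  move=> bv bv' nbb' /(_ _ (memU b bv))[z].
  by rewrite idem_ofE /eps -bv arrowL_src; exact: key.
by case: (ls _ (@vertex_projective v) (@vertex_indecomposable v) _ _ (sU a) (sU a'));
  apply: sub => //; exact: nesym.
Qed.

End BoundQuiverAlgebra.

Theorem proposition6p5 (K : fieldType) (Q : quiver)
    (I : ideal (path_algebra K Q)) :
  admissible I ->
  left_serial (quotient_ring I) ->
  contravariantly_finite (@fin_gen_finite_pdim (quotient_ring I))
    (@fin_gen (quotient_ring I)) /\
  contravariantly_finite (@fin_gen_finite_pdim (quotient_ring I)^c%R)
    (@fin_gen (quotient_ring I)^c%R).
Proof.
move=> admI ls; have srcI := src_inj admI ls; split.
- exact (left_contravariantly_finite (@scalarC _ _ I) srcI (@vertexLK _ _ I)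
    (@vertexL_orth _ _ I) (@vertexL_sum _ _ I) (@vertexL_neq0 _ _ I admI)
    (@arrowL_src _ _ I) (@arrowL_tgt _ _ I) (@arrowL_gen_right _ _ I)
    (arrowL_prod_nil admI) (arrowL_sum_nil admI) (@path_induction _ _ I)).
- exact (right_contravariantly_finite (@scalarC _ _ I) srcI (@vertexLK _ _ I)
    (@vertexL_orth _ _ I) (@vertexL_sum _ _ I) (@vertexL_neq0 _ _ I admI)
    (@arrowL_src _ _ I) (@arrowL_tgt _ _ I) (@arrowL_gen_left _ _ I)
    (arrowL_prod_nil admI) (arrowL_sum_nil admI) (@path_induction _ _ I)).
Qed.
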